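(* Let $p$ be an integer with $|p|=2m+1$, where $m\in\mathbb{N}=\{1,2,3,\dots\}$, and let $\varepsilon\in\mathbb{R}$. Let $A=\begin{bmatrix} p&0\\0&p\end{bmatrix}$ and $$\mathcal{D}_\varepsilon=\left\{\begin{bmatrix} i+b_j\\ j\end{bmatrix}:\ b_j=\frac{1-(-1)^j}{2}\,\varepsilon,\quad i,j\in\{0,\pm1,\dots,\pm m\}\right\}\subset\mathbb{R}^2,$$ and let $T_\varepsilon$ be the self-similar set generated by $(A,\mathcal{D}_\varepsilon)$. Then $T_\varepsilon$ is a self-similar tile. Moreover: (i) if $|\varepsilon|<|p|$, then $T_\varepsilon$ is disk-like; (ii) if $|p|^n\le|\varepsilon|<|p|^{n+1}$ for some integer $n\ge1$, then the interior $T_\varepsilon^\circ$ has exactly $|p|^n$ connected components, and the closure of every component is disk-like.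
   Context: For an expanding matrix $A$ (all eigenvalues of modulus $>1$) and a finite digit set $\mathcal{D}\subset\mathbb{R}^d$, the set generated by $(A,\mathcal{D})$ is the unique nonempty compact set $T\subset\mathbb{R}^d$ with $T=A^{-1}(T+\mathcal{D})=\bigcup_{d\in\mathcal{D}}A^{-1}(T+d)$; equivalently $T=\{\sum_{k\ge1}A^{-k}d_{j_k}: d_{j_k}\in\mathcal{D}\}$. It is called a self-affine set, and a self-similar set if $A$ is a similarity. For $A$ an integer expanding matrix and $\#\mathcal{D}=|\det A|$, such a $T$ is called a self-affine tile (self-similar tile if $A$ is a similarity) if $T$ has nonempty interior $T^\circ$; in that case there is a discrete set $\mathcal{J}\subset\mathbb{R}^d$ such that $T+\mathcal{J}=\mathbb{R}^d$ and $(T^\circ+t)\cap(T^\circ+t')=\emptyset$ for distinct $t,t'\in\mathcal{J}$ (a tiling of $\mathbb{R}^d$). A set in $\mathbb{R}^2$ is disk-like if it is a topological disk, i.e. homeomorphic to the closed unit disk. *)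

(* Defs.v *)
From HB Require Import structures.
From mathcomp Require Import all_boot all_order all_algebra.
From mathcomp Require Import all_classical all_reals all_analysis.
From mathcomp Require Import complex.

Set Implicit Arguments.
Unset Strict Implicit.
Unset Printing Implicit Defensive.

Import Order.TTheory GRing.Theory Num.Theory.
Import numFieldNormedType.Exports.

Local Open Scope classical_set_scope.
Local Open Scope ring_scope.

(* R^d is 'cV[R]_d with its product topology. *)

Definition enorm (R : realType) (d : nat) (x : 'cV[R]_d) : R :=
  Num.sqrt (\sum_i x i 0 ^+ 2).

Definition integer_mx (R : realType) (d : nat) (A : 'M[R]_d) : Prop :=
  forall i j, A i j \is a Num.int.

Definition expanding (R : realType) (d : nat) (A : 'M[R]_d) : Prop :=
  forall z : complex R,
    eigenvalue (map_mx (real_complex R) A) z -> 1 < `|z|.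

Definition similarity_mx (R : realType) (d : nat) (A : 'M[R]_d) : Prop :=
  exists2 r : R, 0 < r &
    forall x y : 'cV[R]_d, enorm (A *m x - A *m y) = r * enorm (x - y).

Definition generated_by (R : realType) (d : nat) (A : 'M[R]_d)
    (D T : set 'cV[R]_d) : Prop :=
  [/\ compact T, T !=set0 &
      T = [set invmx A *m (t + e) | t in T & e in D]].

(* Definite description; the default value set0 is not generated by (A, D),
   so a nonempty self_affine_set is the unique set generated by (A, D). *)
Definition self_affine_set (R : realType) (d : nat) (A : 'M[R]_d)
    (D : set 'cV[R]_d) : set 'cV[R]_d :=
  xget set0 [set T | generated_by A D T /\
                     forall T', generated_by A D T' -> T' = T].

Definition self_affine_tile (R : realType) (d : nat) (A : 'M[R]_d)
    (D T : set 'cV[R]_d) : Prop :=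
  [/\ integer_mx A /\ expanding A,
      exists2 n : nat, (D #= `I_n)%card & n%:R = `|\det A|,
      T = self_affine_set A D &
      T° !=set0].

Definition self_similar_tile (R : realType) (d : nat) (A : 'M[R]_d)
    (D T : set 'cV[R]_d) : Prop :=
  self_affine_tile A D T /\ similarity_mx A.

Definition homeomorphic (X Y : topologicalType) (A : set X) (B : set Y) : Prop :=
  exists (f : X -> Y) (g : Y -> X),
    [/\ (forall x, A x -> B (f x) /\ g (f x) = x),
        (forall y, B y -> A (g y) /\ f (g y) = y),
        {within A, continuous f} &
        {within B, continuous g}].

Definition unit_disk (R : realType) : set 'cV[R]_2 := [set x | enorm x <= 1].
Arguments unit_disk : clear implicits.

Definition disk_like (R : realType) (S : set 'cV[R]_2) : Prop :=
  homeomorphic S (unit_disk R).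

Definition components (X : topologicalType) (U : set X) : set (set X) :=
  [set connected_component U x | x in U].

Definition vec2 (R : realType) (x y : R) : 'cV[R]_2 :=
  \col_(k < 2) if k == 0 then x else y.

Definition digit_shift (R : realType) (eps : R) (j : int) : R :=
  (1 - (-1) ^ j) / 2 * eps.

Definition digits (R : realType) (m : nat) (eps : R) : set 'cV[R]_2 :=
  [set vec2 (i%:~R + digit_shift eps j) j%:~R
     | i in [set i : int | `|i| <= m%:Z] & j in [set j : int | `|j| <= m%:Z]].

(* Main.v *)
Require Import Defs.
From HB Require Import structures.
From mathcomp Require Import all_boot all_order all_algebra.
From mathcomp Require Import all_classical all_reals all_analysis.
From mathcomp Require Import complex.
From mathcomp Require Import ring lra zify.
Import Order.TTheory GRing.Theory Num.Theory.
Import numFieldNormedType.Exports.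
Local Open Scope classical_set_scope.
Local Open Scope ring_scope.

Set Implicit Arguments.
Unset Strict Implicit.
Unset Printing Implicit Defensive.

(** The first coordinate [i] of a digit is free once the shift is removed, so the
    self-affine set is a horizontal thickening of a curve-like set:
      [T = {(s + eps * z, y) : |s| <= 1/2, (z, y) in G}],
    where the digit graph [G] is a compact set invariant under the maps
    [(z, y) |-> ((z + beta_j)/p, (y + j)/p)], with [beta_j = 1] for odd [j] and
    [0] for even [j].  Over [-1/2, 1/2] the set [G] is the closed graph of a
    function with jumps: the fibre over [y] has at most two points, at distance
    at most [1/|p|] (graph_fiber_diam), and where it has two, [y] is rational
    and [G] tends to one of them from below and to the other from above, at a
    linear rate (graph_corner, graph_two_points).

    Let [|eps| < |p|].  The jumps of the scaled graph are smaller than 1, so the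
    left and right boundaries of [T], which are the scaled graph with its jumps
    filled by horizontal segments and translated by [-1/2] and [1/2], do not meet.
    The jumps are dense, hence the ordinate is a bad parameter on these
    boundaries.  A better one is [W = y + sum_n 2^-n-1 psi_n], where [psi_n]
    belongs to the [n]-th jump: it is nondecreasing in [y], strictly monotone on
    the two horizontal segments of that jump, and constant on the rest of both
    boundaries below the jump and above it (jump_separation).  As the terms do
    not interfere, their weights are free, and [W] is injective on each boundary
    (curve_height).  Each level line of [W] then crosses each boundary exactly
    once, at a point depending continuously on the level (level_curve_crossing),
    so [T] is the region between two continuous functions of [W] and is
    homeomorphic to a square (region_between).  The open square gives a connected
    open set that is dense in [T], whence the interior of [T] is connected and
    dense in [T].

    For general [eps], [T] is the union of [|p|] rows, which are affine images of
    the set [T'] of the parameter [eps/p] (tile_rows).  If [|eps| >= |p|], the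
    two slices in which neighbouring rows meet are displaced by [|eps/p| >= 1],
    and no point on the common line is interior to [T] (boundary_slice_limit).
    The interior of [T] is therefore the disjoint union of the interiors of the
    rows (interior_tile_rows), and the number of components is multiplied by
    [|p|] when [eps/p] is replaced by [eps]; the induction starts at
    [|eps| < |p|] (tile_components).

    That [T] is the set generated by the digits follows from the invariance of
    [G], together with uniqueness, which is a contraction argument
    (tile_generated, generated_subset). *)

(** * Coordinates, homeomorphisms and continuous functions *)

Section Plane.
Variable R : realType.
Local Notation V := 'cV[R]_2.

Definition abscissa (v : V) : R := v 0 0.
Definition ordinate (v : V) : R := v 1 0.
Local Notation X := abscissa.
Local Notation Y := ordinate.

Lemma abscissa_vec2 (x y : R) : X (vec2 x y) = x.
Proof. by rewrite /X mxE. Qed.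

Lemma ordinate_vec2 (x y : R) : Y (vec2 x y) = y.
Proof. by rewrite /Y mxE. Qed.

Definition coordE := (abscissa_vec2, ordinate_vec2).

Lemma vec2_eq (v w : V) : X v = X w -> Y v = Y w -> v = w.
Proof.
move=> hx hy; apply/matrixP => i j; rewrite (ord1 j).
case: i => [[|[|//]] hi].
- by move: hx; rewrite /X; congr (_ = _); congr fun_of_matrix; apply: val_inj.
- by move: hy; rewrite /Y; congr (_ = _); congr fun_of_matrix; apply: val_inj.
Qed.

Lemma vec2_surj (v : V) : vec2 (X v) (Y v) = v.
Proof. by apply: vec2_eq; rewrite coordE. Qed.

Lemma continuous_abscissa : continuous X.
Proof. exact: coord_continuous. Qed.

Lemma continuous_ordinate : continuous Y.
Proof. exact: coord_continuous. Qed.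

Lemma continuous_vec2 (T : topologicalType) (f g : T -> R) :
  continuous f -> continuous g -> continuous (fun t => vec2 (f t) (g t)).
Proof.
move=> cf cg t; apply/cvg_ballP => e e0.
have /cvg_ballP/(_ e e0) nf := cf t.
have /cvg_ballP/(_ e e0) ng := cg t.
near=> u; split=> // i j; rewrite !mxE.
by case: ifP => _; [near: u; exact: nf | near: u; exact: ng].
Unshelve. all: by end_near. Qed.

Lemma abscissaB (v w : V) : X (v - w) = X v - X w.
Proof. by rewrite /X !mxE. Qed.
Lemma ordinateB (v w : V) : Y (v - w) = Y v - Y w.
Proof. by rewrite /Y !mxE. Qed.
Lemma abscissaD (v w : V) : X (v + w) = X v + X w.
Proof. by rewrite /X !mxE. Qed.
Lemma ordinateD (v w : V) : Y (v + w) = Y v + Y w.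
Proof. by rewrite /Y !mxE. Qed.
Lemma abscissaZ a (v : V) : X (a *: v) = a * X v.
Proof. by rewrite /X !mxE. Qed.
Lemma ordinateZ a (v : V) : Y (a *: v) = a * Y v.
Proof. by rewrite /Y !mxE. Qed.

Lemma sup_norm_plane (v : V) : `|v| = Num.max `|X v| `|Y v|.
Proof.
rewrite [LHS](mx_normrE v); apply/eqP; rewrite eq_le; apply/andP; split.
  apply/bigmax_leP; split=> [|[i j] _]; first by rewrite le_max normr_ge0.
  rewrite (ord1 j) /= le_max; case: i => [[|[|//]] hi].
  - by apply/orP; left; rewrite le_eqVlt; apply/orP; left; apply/eqP;
      rewrite /X; do 2 f_equal; apply: val_inj.
  - by apply/orP; right; rewrite le_eqVlt; apply/orP; left; apply/eqP;
      rewrite /Y; do 2 f_equal; apply: val_inj.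
rewrite ge_max; apply/andP; split; apply/bigmax_geP; right.
- by exists (0, 0).
- by exists (1, 0).
Qed.

Lemma enorm_plane (v : V) : enorm v = Num.sqrt (X v ^+ 2 + Y v ^+ 2).
Proof. by rewrite /enorm !big_ord_recl big_ord0 addr0 /X /Y; do 4 f_equal; apply: val_inj. Qed.

End Plane.

Section HomeomorphismTransport.
Variables (S T : topologicalType) (h : S -> T) (k : T -> S).
Hypotheses (ch : continuous h) (ck : continuous k).
Hypotheses (hk : cancel h k) (kh : cancel k h).

Lemma image_cancel (A : set S) : h @` A = k @^-1` A.
Proof.
apply/seteqP; split=> [_ [x Ax <-]|y Ay]; first by rewrite /preimage /= hk.
by exists (k y) => //; rewrite kh.
Qed.

Lemma interior_homeo (A : set S) : (h @` A)° = h @` A°.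
Proof.
apply/seteqP; split=> [y Ay|_ [x Ax <-]].
  exists (k y); last by rewrite kh.
  have : nbhs (k y) (h @^-1` (h @` A)) by apply: ch; rewrite kh.
  by apply: filterS => x [x' Ax' /(can_inj hk) <-].
rewrite /interior /= image_cancel; apply: ck; rewrite hk; exact: Ax.
Qed.

Lemma closure_homeo (A : set S) : closure (h @` A) = h @` closure A.
Proof.
rewrite [RHS]image_cancel; apply/seteqP; split=> y cy.
  move=> B By.
  have [_ [[x Ax <-] Bx]] : h @` A `&` k @^-1` B !=set0 by apply: cy; apply: ck.
  by exists x; split=> //; move: Bx; rewrite /preimage /= hk.
move=> B By.
have [x [Ax Bx]] : A `&` h @^-1` B !=set0 by apply: cy; apply: ch; rewrite kh.
by exists (h x); split=> //; exists x.
Qed.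

Lemma connected_homeo (A : set S) : connected A -> connected (h @` A).
Proof.
move=> cA; apply: connected_continuous_connected => //.
exact: continuous_subspaceT.
Qed.

End HomeomorphismTransport.

Lemma connected_component_homeo (S T : topologicalType) (h : S -> T) (k : T -> S)
    (ch : continuous h) (ck : continuous k) (hk : cancel h k) (kh : cancel k h)
    (A : set S) (x : S) : A x ->
  connected_component (h @` A) (h x) = h @` connected_component A x.
Proof.
move=> Ax; apply/seteqP; split; last first.
  apply: connected_component_max.
  - by exists x => //; exact: connected_component_refl.
  - by apply: image_subset; exact: connected_component_sub.
  - by apply: connected_homeo => //; exact: component_connected.
have /(connected_homeo ck) cc := @component_connected _ (h @` A) (h x).
move=> y hy; exists (k y); last by rewrite kh.
apply: (connected_component_max _ _ cc).
- by exists (h x); rewrite ?hk //; apply: connected_component_refl; exists x.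
- by move=> _ [z /connected_component_sub [w Aw <-] <-]; rewrite hk.
- by exists y.
Qed.

Lemma homeomorphic_image (S T W : topologicalType) (h : S -> T) (k : T -> S)
    (ch : continuous h) (ck : continuous k) (hk : cancel h k) (kh : cancel k h)
    (A : set S) (B : set W) :
  homeomorphic A B -> homeomorphic (h @` A) B.
Proof.
case=> f [g [fg gf cf cg]]; exists (f \o k), (h \o g); split.
- by move=> _ [x Ax <-] /=; rewrite hk; have [? ->] := fg x Ax.
- move=> y By /=; have [Ag fgy] := gf y By; rewrite hk.
  by split=> //; exists (g y).
- apply/subspace_continuousP => _ [x Ax <-] /=.
  apply: (@cvg_comp _ _ _ k f _ (within A (nbhs x))); last first.
    by rewrite /from_subspace /= hk; move/subspace_continuousP: cf; apply.
    move=> U /= AU; have : nbhs (h x) (k @^-1` [set y | A y -> U y]).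
      by apply: ck; rewrite hk.
    by apply: filterS => y /= yU [z Az hz]; apply: yU; rewrite -hz hk.
- move=> y; apply: (@continuous_comp (subspace B) S T g h) => //; [exact: cg|exact: ch].
Qed.

Section RealFunctions.
Variables (R : realType) (T : topologicalType).
Implicit Types f g : T -> R.

Lemma continuous_near_gt f t c : {for t, continuous f} -> c < f t ->
  \forall u \near t, c < f u.
Proof. by move=> cf; exact: cvgr_gt cf c. Qed.

Lemma continuous_near_lt f t c : {for t, continuous f} -> f t < c ->
  \forall u \near t, f u < c.
Proof. by move=> cf; exact: cvgr_lt cf c. Qed.

Lemma open_lt_continuous f g : continuous f -> continuous g ->
  open [set t | f t < g t].
Proof.
move=> cf cg; rewrite openE => t /= ft.
have /continuous_near_gt : {for t, continuous (fun u => g u - f u)}.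
  exact: cvgB (cg t) (cf t).
move=> /(_ 0); rewrite subr_gt0 => /(_ ft).
by apply: filterS => u; rewrite subr_gt0.
Qed.

Lemma closed_le_continuous f g : continuous f -> continuous g ->
  closed [set t | f t <= g t].
Proof.
move=> cf cg; rewrite -openC (_ : ~` _ = [set t | g t < f t]).
  exact: open_lt_continuous.
by apply/seteqP; split=> t /=; rewrite ltNge => /negP.
Qed.

Lemma continuous_of_dist f :
  (forall t e, 0 < e -> \forall u \near t, `|f t - f u| < e) -> continuous f.
Proof. by move=> h t; apply/cvgrPdist_lt => e e0; exact: h. Qed.

Lemma continuous_add f g : continuous f -> continuous g ->
  continuous (fun t => f t + g t).
Proof. by move=> cf cg t; exact: cvgD (cf t) (cg t). Qed.

Lemma continuous_sub f g : continuous f -> continuous g ->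
  continuous (fun t => f t - g t).
Proof. by move=> cf cg t; exact: cvgB (cf t) (cg t). Qed.

Lemma continuous_mul f g : continuous f -> continuous g ->
  continuous (fun t => f t * g t).
Proof. by move=> cf cg t; exact: cvgM (cf t) (cg t). Qed.

Lemma continuous_inv f : continuous f -> (forall t, f t != 0) ->
  continuous (fun t => (f t)^-1).
Proof. by move=> cf f0 t; exact: cvgV (f0 t) (cf t). Qed.

Lemma continuous_after (S : topologicalType) (k : S -> T) f :
  continuous k -> continuous f -> continuous (fun s => f (k s)).
Proof. by move=> ck cf s; exact: continuous_comp (ck s) (cf _). Qed.

Lemma continuous_const (c : R) : continuous (fun _ : T => c).
Proof. exact: cst_continuous. Qed.

End RealFunctions.

Section Clamp.
Variable R : realType.

Definition clamp (a b t : R) : R := Num.max a (Num.min b t).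

Lemma continuous_clamp a b : continuous (clamp a b).
Proof.
move=> t; apply: continuous_max; first exact: cst_continuous.
by apply: continuous_min; [exact: cst_continuous|exact: cvg_id].
Qed.

Lemma clamp_bounds a b t : a <= b -> a <= clamp a b t <= b.
Proof. by move=> ab; rewrite /clamp le_max lexx /= ge_max ab ge_min lexx. Qed.

Lemma clamp_id a b t : a <= t <= b -> clamp a b t = t.
Proof. by move=> /andP[h0 h1]; rewrite /clamp (min_idPr h1) (max_idPr h0). Qed.

Lemma clamp_mono a b : {homo clamp a b : x y / x <= y}.
Proof. by move=> x y xy; rewrite /clamp le_max2 // le_min2. Qed.

End Clamp.

(** * Squares are disks *)

Section SquareDisk.
Variable R : realType.
Local Notation V := 'cV[R]_2.
Local Notation X := (@abscissa R).
Local Notation Y := (@ordinate R).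

Lemma enorm_ge0 (v : V) : 0 <= enorm v.
Proof. exact: sqrtr_ge0. Qed.

Lemma enormZ a (v : V) : enorm (a *: v) = `|a| * enorm v.
Proof.
rewrite !enorm_plane abscissaZ ordinateZ !exprMn -mulrDr sqrtrM ?sqr_ge0 //.
by rewrite sqrtr_sqr.
Qed.

Lemma enorm_ge_sup (v : V) : `|v| <= enorm v.
Proof.
rewrite sup_norm_plane enorm_plane ge_max -!sqrtr_sqr.
by rewrite !ler_wsqrtr // ?lerDl ?lerDr sqr_ge0.
Qed.

Lemma enorm_le_sup (v : V) : enorm v <= 2 * `|v|.
Proof.
have v0 : 0 <= `|v| by exact: normr_ge0.
rewrite -[leRHS]ger0_norm ?mulr_ge0 // -sqrtr_sqr enorm_plane ler_wsqrtr //.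
have : X v ^+ 2 <= `|v| ^+ 2.
  by rewrite -(real_normK (num_real (X v))) lerXn2r ?nnegrE // sup_norm_plane le_max lexx.
have : Y v ^+ 2 <= `|v| ^+ 2.
  by rewrite -(real_normK (num_real (Y v))) lerXn2r ?nnegrE // sup_norm_plane le_max lexx orbT.
nra.
Qed.

Lemma continuous_enorm : continuous (@enorm R 2).
Proof.
move=> v; rewrite (_ : @enorm R 2 = Num.sqrt \o (fun v => X v * X v + Y v * Y v)).
  apply: continuous_comp; last exact: sqrt_continuous.
  have cX := @continuous_abscissa R v; have cY := @continuous_ordinate R v.
  by apply: (cvgD (cvgM cX cX) (cvgM cY cY)).
by apply/funext => w; rewrite enorm_plane !expr2.
Qed.

(** The bound is what gives continuity at the origin, where the quotient
    jumps to the junk value of a division by zero. *)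
Lemma continuous_radial (n1 n2 : V -> R) (C : R) :
  continuous n1 -> continuous n2 -> (forall v, n2 v = 0 -> v = 0) ->
  (forall v, `|n1 v| <= C * `|n2 v|) ->
  continuous (fun v => (n1 v / n2 v) *: v).
Proof.
move=> c1 c2 h2 h v; have [->|v0] := eqVneq v 0; last first.
  have n2v : n2 v != 0 by apply: contra v0 => /eqP/h2/eqP.
  exact: (cvgZ (cvgM (c1 v) (cvgV n2v (c2 v))) (@cvg_id _ (nbhs v))).
apply/(@cvgrPdist_lt R V V (nbhs (0 : V)) (nbhs_filter _)) => e e0; near=> w; rewrite scaler0 sub0r normrN.
have hC : `|n1 w / n2 w| <= `|C| + 1.
  have [->|n2w] := eqVneq (n2 w) 0; first by rewrite invr0 mulr0 normr0 addr_ge0.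
  rewrite normrM normfV ler_pdivrMr ?normr_gt0 //.
  apply: le_trans (h w) _; rewrite ler_wpM2r //.
  by rewrite (le_trans (ler_norm _)) // lerDl.
have C0 : 0 < `|C| + 1 by rewrite ltr_wpDl.
rewrite normrZ; apply: le_lt_trans (ler_wpM2r (normr_ge0 w) hC) _.
rewrite -ltr_pdivlMl // mulrC; near: w.
have := @nbhs0_lt R V (e / (`|C| + 1)); apply.
by rewrite divr_gt0.
Unshelve. all: by end_near. Qed.

(** The sup-norm ball is carried to the Euclidean ball, and back, by the radial
    maps that exchange the two norms. *)
Lemma disk_like_of_square (S : set V) (f g : V -> V) :
  continuous f -> continuous g ->
  (forall v, S v -> `|f v| <= 1 /\ g (f v) = v) ->
  (forall v, `|v| <= 1 -> S (g v) /\ f (g v) = v) ->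
  disk_like S.
Proof.
move=> cf cg fS gS.
pose a (v : V) : V := (`|v| / enorm v) *: v.
pose b (v : V) : V := (enorm v / `|v|) *: v.
have en0 (v : V) : enorm v = 0 -> v = 0.
  by move=> h; apply/normr0_eq0/eqP; rewrite eq_le normr_ge0 andbT; have := enorm_ge_sup v; rewrite h.
have ca : continuous a.
  apply: (@continuous_radial _ _ 1) => //; [exact: norm_continuous|exact: continuous_enorm|].
  by move=> v; rewrite mul1r normr_id ger0_norm ?enorm_ge0 // enorm_ge_sup.
have cb : continuous b.
  apply: (@continuous_radial _ _ 2) => //; [exact: continuous_enorm|exact: norm_continuous|exact: normr0_eq0|].
  by move=> v; rewrite normr_id ger0_norm ?enorm_ge0 // enorm_le_sup.
have na (v : V) : enorm (a v) = `|v|.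
  rewrite /a enormZ normrM normfV normr_id (ger0_norm (enorm_ge0 v)).
  have [/en0 ->|v0] := eqVneq (enorm v) 0; first by rewrite normr0 !mul0r.
  by rewrite divfK.
have nb (v : V) : `|b v| = enorm v.
  rewrite /b normrZ normrM normfV normr_id (ger0_norm (enorm_ge0 v)).
  have [v0|v0] := eqVneq `|v| 0; last by rewrite divfK.
  by rewrite v0 mulr0 (normr0_eq0 v0) enorm_plane /X /Y !mxE expr0n /= addr0 sqrtr0.
have ab (v : V) : a (b v) = v.
  rewrite {1}/a nb; have [->|v0] := eqVneq v 0; first by rewrite /b !scaler0.
  have v1 : `|v| != 0 by rewrite normr_eq0.
  have v2 : enorm v != 0 by apply: contra v0 => /eqP/en0/eqP.
  rewrite /b enormZ normrM normfV normr_id (ger0_norm (enorm_ge0 v)) scalerA.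
  by rewrite [X in X *: _](_ : _ = 1) ?scale1r //; field; apply/andP.
have ba (v : V) : b (a v) = v.
  rewrite {1}/b na; have [->|v0] := eqVneq v 0; first by rewrite /a !scaler0.
  have v1 : `|v| != 0 by rewrite normr_eq0.
  have v2 : enorm v != 0 by apply: contra v0 => /eqP/en0/eqP.
  rewrite /a normrZ normrM normfV normr_id (ger0_norm (enorm_ge0 v)) scalerA.
  by rewrite [X in X *: _](_ : _ = 1) ?scale1r //; field; apply/andP.
exists (a \o f), (g \o b); split.
- by move=> v /fS[f1 gf]; rewrite /unit_disk /= na ba.
- by move=> v; rewrite /unit_disk /= -nb => /gS[Sg fg]; rewrite fg ab.
- by apply: continuous_subspaceT => v; apply: continuous_comp; [exact: cf|exact: ca].
- by apply: continuous_subspaceT => v; apply: continuous_comp; [exact: cb|exact: cg].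
Qed.
End SquareDisk.

Lemma disk_like_image (R : realType) (h k : 'cV[R]_2 -> 'cV[R]_2)
    (ch : continuous h) (ck : continuous k) (hk : cancel h k) (kh : cancel k h)
    (A : set 'cV[R]_2) : disk_like A -> disk_like (h @` A).
Proof. by move=> dA; apply: (homeomorphic_image ch ck hk kh dA). Qed.

(** * Regions cut out by level curves of a height *)

Section LevelCurves.
Variable R : realType.
Local Notation V := 'cV[R]_2.
Local Notation X := (@abscissa R).
Local Notation Y := (@ordinate R).

Definition strip : set V := [set v | - (1 / 2) <= Y v <= 1 / 2].

(** A substitute for the ordinate: it has the same horizontal edges of the
    strip as level lines, but its other level lines may be bent. *)
Record height_function (W : V -> R) (w0 w1 : R) : Prop := HeightFunction {
  height_continuous : continuous W;
  height_increasing : forall v w, X v = X w -> Y v < Y w -> W v < W w;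
  height_bounds : forall v, Y v <= W v <= Y v + 1;
  height_bottom : forall v, Y v = - (1 / 2) -> W v = w0;
  height_top : forall v, Y v = 1 / 2 -> W v = w1 }.

Variables (W : V -> R) (w0 w1 : R).
Hypothesis hW : height_function W w0 w1.

Lemma height_le v w : X v = X w -> (W v <= W w) = (Y v <= Y w).
Proof.
move=> vw; case: (ltgtP (Y v) (Y w)) => h.
- by rewrite ltW //; apply: (height_increasing hW).
- by apply/negbTE; rewrite -ltNge; apply: (height_increasing hW).
- by rewrite (vec2_eq vw h) lexx.
Qed.

Lemma height_lt v w : X v = X w -> (W v < W w) = (Y v < Y w).
Proof. by move=> vw; rewrite !ltNge height_le. Qed.

Lemma height_edges : w0 < w1.
Proof.
rewrite -(height_bottom hW (ordinate_vec2 0 _)) -(height_top hW (ordinate_vec2 0 _)).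
by rewrite height_lt ?coordE //; lra.
Qed.

Lemma strip_height v : strip v <-> w0 <= W v <= w1.
Proof.
rewrite /strip /=.
rewrite -(height_bottom hW (ordinate_vec2 (X v) _)) -(height_top hW (ordinate_vec2 (X v) _)).
by rewrite !height_le ?coordE.
Qed.

(** The map that sends [v] to its abscissa and its height is a homeomorphism of
    the plane; [Th] is its inverse, continuous because heights increase strictly
    on vertical lines. *)
Lemma height_inverse : exists2 Th : V -> V, continuous Th &
  forall q, X (Th q) = X q /\ W (Th q) = Y q.
Proof.
have ex q : exists y, W (vec2 (X q) y) = Y q.
  have cW : {within `[Y q - 1, Y q], continuous (fun y => W (vec2 (X q) y))}.
    apply: continuous_subspaceT => y; apply: continuous_comp.
      exact: (continuous_vec2 (fun=> @cvg_cst _ _ _ _ _) (fun=> @cvg_id _ _)).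
    exact: (height_continuous hW).
  have lq : Y q - 1 <= Y q by lra.
  have [|y _ ?] := IVT lq cW (v := Y q); last by exists y.
  have /andP[_] := height_bounds hW (vec2 (X q) (Y q - 1)).
  have /andP[h2 _] := height_bounds hW (vec2 (X q) (Y q)).
  by rewrite ge_min le_max; move: h2; rewrite !coordE subrK => -> ->; rewrite orbT.
have [H hH] := choice ex.
exists (fun q => vec2 (X q) (H q)); last by move=> q; rewrite coordE hH.
apply: continuous_vec2; first exact: continuous_abscissa.
apply: continuous_of_dist => q e e0.
have cW a : continuous (fun r : V => W (vec2 (X r) a)).
  have cv : continuous (fun r : V => vec2 (X r) a).
    apply: continuous_vec2; first exact: continuous_abscissa.
    exact: cst_continuous.
  by move=> r; apply: continuous_comp (cv r) _; exact: (height_continuous hW).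
have cl a : continuous (fun r : V => Y r - W (vec2 (X r) a)).
  by move=> r; exact: cvgB (@continuous_ordinate R r) (cW a r).
have below : 0 < Y q - W (vec2 (X q) (H q - e)).
  by rewrite subr_gt0 -[ltRHS]hH height_lt ?coordE // ltrBlDr ltrDl.
have above : Y q - W (vec2 (X q) (H q + e)) < 0.
  by rewrite subr_lt0 -[ltLHS]hH height_lt ?coordE // ltrDl.
apply: filterS2 (continuous_near_gt (cl _ q) below)
  (continuous_near_lt (cl _ q) above) => r.
rewrite subr_gt0 subr_lt0 -(hH r) !height_lt ?coordE // => h1 h2.
by rewrite ltr_distl; apply/andP; split; lra.
Qed.
Lemma height_inj v w : X v = X w -> W v = W w -> v = w.
Proof.
move=> vw Wvw; apply: vec2_eq => //; apply: le_anti.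
by rewrite -!height_le // Wvw lexx.
Qed.

(** [A] and [B] are the two closed sides of a curve [A `&` B].  A level line is
    connected and runs from [B] to [A], so it meets the curve; injectivity of
    the height allows one meeting point only, and closedness of the sides makes
    it depend continuously on the level. *)
Lemma level_curve_crossing (A B : set V) (M : R) :
  closed A -> closed B -> (forall v, strip v -> A v \/ B v) ->
  (forall v, strip v -> X v <= - M -> ~ A v) ->
  (forall v, strip v -> M <= X v -> ~ B v) ->
  (forall v w, strip v -> strip w -> A v -> B v -> A w -> B w ->
    W v = W w -> v = w) ->
  exists2 e : R -> R, continuous e & forall v, strip v ->
    (A v <-> e (W v) <= X v) /\ (B v <-> X v <= e (W v)).
Proof.
move=> clA clB AB farA farB injW.
have [Th cTh hTh] := height_inverse.
pose c := clamp w0 w1.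
have cc : continuous c by exact: continuous_clamp.
have cin t : w0 <= c t <= w1 by apply: clamp_bounds; exact: ltW height_edges.
have cid t : w0 <= t <= w1 -> c t = t by exact: clamp_id.
pose th x t := Th (vec2 x (c t)).
have thX x t : X (th x t) = x by rewrite (hTh _).1 coordE.
have thW x t : W (th x t) = c t by rewrite (hTh _).2 coordE.
have thS x t : strip (th x t) by apply/strip_height; rewrite thW.
have cth1 t : continuous (th^~ t).
  move=> x; apply: (@continuous_comp _ _ _ (fun y => vec2 y (c t)) Th); last exact: cTh.
  apply: continuous_vec2; first by move=> ?; exact: cvg_id.
  exact: cst_continuous.
have cth2 x : continuous (th x).
  move=> t; apply: (@continuous_comp _ _ _ (fun t => vec2 x (c t)) Th); last exact: cTh.
  by apply: continuous_vec2; [exact: cst_continuous|exact: cc].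
have thK v : strip v -> th (X v) (W v) = v.
  by move=> sv; apply: height_inj; rewrite ?thX // thW cid //; apply/strip_height.
have nearN (F : set V) x t : closed F -> ~ F (th x t) -> nbhs x [set y | ~ F (th y t)].
  move=> clF nF; have nb : nbhs (th x t) (~` F).
    by apply: open_nbhs_nbhs; split => //; rewrite openC.
  exact: (cth1 t x _ nb).
(* The crossing point is the last point of the level line up to [b] in [B]. *)
have cross a b t : a <= b -> B (th a t) -> A (th b t) ->
    exists2 x, a <= x <= b & A (th x t) /\ B (th x t).
  move=> ab Ba Ab; pose E := [set x | x <= b /\ B (th x t)].
  have Ea : E a by [].
  have ubE : ubound E b by move=> x [].
  have hasE : has_ubound E by exists b.
  have sb : sup E <= b by apply: ge_sup => //; exists a.
  have as_ : a <= sup E by exact: ub_le_sup.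
  have Bs : B (th (sup E) t).
    apply: contrapT => nB.
    have [x [[_ Bx]]] := closure_sup (ex_intro _ _ Ea) hasE (nearN _ _ _ clB nB).
    exact.
  exists (sup E); rewrite ?as_ ?sb //; split=> //; apply: contrapT => nA.
  have [d d0 hd] := (nbhs_ballP _ _).1 (nearN _ _ _ clA nA).
  have sltb : sup E < b.
    rewrite lt_neqAle sb andbT; apply/eqP => sE; apply: nA.
    by rewrite sE.
  pose x := Num.min b (sup E + d / 2).
  have sx : sup E < x by rewrite lt_min sltb ltrDl divr_gt0.
  have xd : x <= sup E + d / 2 by rewrite ge_min lexx orbT.
  suff /(ub_le_sup hasE) : E x by rewrite leNgt sx.
  split; first by rewrite ge_min lexx.
  have /hd /= nAx : ball (sup E) d x.
    by rewrite /ball /= distrC ger0_norm; lra.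
  by case: (AB (th x t) (thS _ _)).
have farB' x t : x <= - M -> B (th x t).
  move=> xM; case: (AB (th x t) (thS _ _)) => // Ax.
  by have [] := farA _ (thS x t) _ Ax; rewrite thX.
have farA' x t : M <= x -> A (th x t).
  move=> xM; case: (AB (th x t) (thS _ _)) => // Bx.
  by have [] := farB _ (thS x t) _ Bx; rewrite thX.
have ex t : exists x, A (th x t) /\ B (th x t).
  have [|||x _ ?] := cross (- M) (Num.max (- M) M) t; last by exists x.
  - by rewrite le_max lexx.
  - exact: farB'.
  - by apply: farA'; rewrite le_max lexx orbT.
have [e he] := choice ex.
have uniq x t : A (th x t) -> B (th x t) -> x = e t.
  move=> Ax Bx; have [Ae Be] := he t.
  by rewrite -(thX x t) (injW (th x t) (th (e t) t)) // !thW.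
have below x t : A (th x t) <-> e t <= x.
  split=> [Ax|].
    rewrite leNgt; apply/negP => xe.
    have [|||y /andP[_ yx] [Ay By]] := cross (Num.min (- M) x) x t.
    - by rewrite ge_min lexx orbT.
    - by apply: farB'; rewrite ge_min lexx.
    - by [].
    - by move: xe; rewrite -(uniq _ _ Ay By) ltNge yx.
  rewrite le_eqVlt => /predU1P[<-|ex']; first by case: (he t).
  case: (AB (th x t) (thS _ _)) => // Bx.
  have [|||y /andP[xy _] [Ay By]] := cross x (Num.max M x) t.
  - by rewrite le_max lexx orbT.
  - by [].
  - by apply: farA'; rewrite le_max lexx.
  - by move: ex'; rewrite -(uniq _ _ Ay By) ltNge xy.
have above x t : B (th x t) <-> x <= e t.
  split=> [Bx|].
    rewrite leNgt; apply/negP => ex'.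
    have Ax : A (th x t) by apply/below/ltW.
    by move: ex'; rewrite -(uniq _ _ Ax Bx) ltxx.
  rewrite le_eqVlt => /predU1P[->|xe]; first by case: (he t).
  case: (AB (th x t) (thS _ _)) => // /below.
  by rewrite leNgt xe.
exists e; last by move=> v sv; rewrite -(below (X v)) -(above (X v)) thK.
have nearN2 (F : set V) x t : closed F -> ~ F (th x t) -> nbhs t [set u | ~ F (th x u)].
  move=> clF nF; have nb : nbhs (th x t) (~` F).
    by apply: open_nbhs_nbhs; split => //; rewrite openC.
  exact: (cth2 x t _ nb).
apply: continuous_of_dist => t d d0.
have nl : ~ A (th (e t - d) t) by move/below; lra.
have nr : ~ B (th (e t + d) t) by move/above; lra.
apply: filterS2 (nearN2 _ _ _ clA nl) (nearN2 _ _ _ clB nr) => u /= h1 h2.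
rewrite ltr_distl; apply/andP; split; rewrite ltNge; apply/negP => h.
- by apply: h2; apply/above; lra.
- by apply: h1; apply/below; lra.
Qed.

(** [A] is the side to the right of the curve and [B] the side to the left. *)
Definition curve_sides (A B : set V) (M : R) : Prop :=
  [/\ closed A /\ closed B, (forall v, strip v -> A v \/ B v),
   (forall v, strip v -> X v <= - M -> ~ A v),
   (forall v, strip v -> M <= X v -> ~ B v) &
   (forall v w, strip v -> strip w -> A v -> B v -> A w -> B w ->
    W v = W w -> v = w)].

Lemma norm_plane_le (v : V) a : `|v| <= a <-> (- a <= X v <= a) /\ (- a <= Y v <= a).
Proof.
rewrite sup_norm_plane ge_max !ler_norml.
by split=> [/andP[]|[-> ->]].
Qed.

(** In the coordinates given by the abscissa and the height, the region lies
    between the graphs of two continuous functions and is rescaled to a square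
    along the level lines.  The set [U] is the image of the open square. *)
Lemma region_between (Al Bl Ar Br : set V) (M : R) :
  curve_sides Al Bl M -> curve_sides Ar Br M ->
  (forall v, strip v -> Al v -> Bl v -> ~ Ar v) ->
  let T := [set v | [/\ strip v, Al v & Br v]] in
  disk_like T /\
  exists U : set V, [/\ open U, connected U, U !=set0, U `<=` T & T `<=` closure U].
Proof.
case=> [[? ?] ? ? ? ?] [[? ?] ? ? ? ?] sep T.
have [el cel hel] : exists2 e : R -> R, continuous e & forall v, strip v ->
    (Al v <-> e (W v) <= X v) /\ (Bl v <-> X v <= e (W v)).
  exact: (level_curve_crossing (M := M)).
have [er cer her] : exists2 e : R -> R, continuous e & forall v, strip v ->
    (Ar v <-> e (W v) <= X v) /\ (Br v <-> X v <= e (W v)).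
  exact: (level_curve_crossing (M := M)).
have [Th cTh hTh] := height_inverse.
have w01 := height_edges.
pose c := clamp w0 w1.
have cc : continuous c by exact: continuous_clamp.
have cin t : w0 <= c t <= w1 by apply: clamp_bounds; exact: ltW.
have cid t : w0 <= t <= w1 -> c t = t by exact: clamp_id.
pose L t := el (c t); pose D t := er (c t) - el (c t).
have cL : continuous L by exact: continuous_after cc cel.
have cD : continuous D.
  exact: continuous_sub (continuous_after cc cer) (continuous_after cc cel).
have D0 t : 0 < D t.
  rewrite subr_gt0 ltNge; apply/negP => h.
  pose v := Th (vec2 (el (c t)) (c t)).
  have [vX vW] : X v = el (c t) /\ W v = c t.
    by rewrite /v; have [-> ->] := hTh (vec2 (el (c t)) (c t)); rewrite !coordE.
  have sv : strip v by apply/strip_height; rewrite vW.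
  have [Alv Blv] := hel v sv; have [Arv _] := her v sv.
  apply: (sep v sv).
  - by apply/Alv; rewrite vX vW.
  - by apply/Blv; rewrite vX vW.
  - by apply/Arv; rewrite vX vW.
have TE v : T v <-> (w0 <= W v <= w1) /\ L (W v) <= X v <= L (W v) + D (W v).
  rewrite /T /=; split=> [[sv]|[/[dup] Wv /strip_height sv]].
  - have /strip_height Wv := sv; have [-> _] := hel v sv; have [_ ->] := her v sv.
    by rewrite /L /D cid // addrC subrK => -> ->.
  - have [Al1 _] := hel v sv; have [_ Br1] := her v sv.
    rewrite /L /D cid // addrC subrK => /andP[h1 h2].
    by split=> //; [apply/Al1|apply/Br1].
pose f (v : V) : V := vec2 (2 * ((X v - L (W v)) / D (W v)) - 1)
                 (2 * ((W v - w0) / (w1 - w0)) - 1).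
pose h (q : V) : R := w0 + (Y q + 1) / 2 * (w1 - w0).
pose x (q : V) : R := L (h q) + (X q + 1) / 2 * D (h q).
pose g (q : V) : V := Th (vec2 (x q) (c (h q))).
have gX q : X (g q) = x q by rewrite /g (hTh _).1 coordE.
have gW q : W (g q) = c (h q) by rewrite /g (hTh _).2 coordE.
have w01' : w1 - w0 != 0 by rewrite subr_eq0 gt_eqF.
have D0' t : D t != 0 by rewrite gt_eqF.
have hin q : - 1 <= Y q <= 1 -> w0 <= h q <= w1 by rewrite /h; nra.
have cW := height_continuous hW.
have cX := @continuous_abscissa R; have cY := @continuous_ordinate R.
have cLW := continuous_after cW cL; have cDW := continuous_after cW cD.
have cf : continuous f.
  apply: continuous_vec2; apply: continuous_sub; try exact: continuous_const;
    apply: continuous_mul; try exact: continuous_const;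
    apply: continuous_mul; try exact: continuous_const.
  - exact: continuous_sub cX cLW.
  - by apply: continuous_inv => // v; exact: D0'.
  - by apply: continuous_sub => //; exact: continuous_const.
have ch : continuous h.
  apply: continuous_add; first exact: continuous_const.
  apply: continuous_mul; last exact: continuous_const.
  apply: continuous_mul; last exact: continuous_const.
  by apply: continuous_add; [exact: cY|exact: continuous_const].
have cx : continuous x.
  apply: continuous_add; first exact: continuous_after ch cL.
  apply: continuous_mul; last exact: continuous_after ch cD.
  apply: continuous_mul; last exact: continuous_const.
  by apply: continuous_add; [exact: cX|exact: continuous_const].
have cg : continuous g.
  move=> q; apply: (@continuous_comp _ _ _ (fun q => vec2 (x q) (c (h q))) Th); last exact: cTh.
  by apply: continuous_vec2 => // r; exact: continuous_comp (ch r) (cc _).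
have fg q : `|q| <= 1 -> T (g q) /\ f (g q) = q.
  move=> /norm_plane_le[Xq Yq]; have hq := hin _ Yq.
  split.
    apply/TE; rewrite gW gX cid //; split=> //; rewrite /x.
    by have := D0 (h q); nra.
  apply: vec2_eq; rewrite /f coordE gW ?gX cid // /x /h.
    by field.
  by field.
have gf v : T v -> `|f v| <= 1 /\ g (f v) = v.
  move=> /TE[Wv Xv].
  have Yf : - 1 <= Y (f v) <= 1.
    rewrite /f coordE; suff : 0 <= (W v - w0) / (w1 - w0) <= 1 by lra.
    by rewrite ler_pdivlMr ?ler_pdivrMr ?subr_gt0 // mul0r mul1r; lra.
  have hf : h (f v) = W v by rewrite /h /f coordE; field.
  split.
    apply/norm_plane_le; split=> //; rewrite /f coordE.
    suff : 0 <= (X v - L (W v)) / D (W v) <= 1 by lra.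
    by rewrite ler_pdivlMr ?ler_pdivrMr // mul0r mul1r; lra.
  apply: height_inj; last by rewrite gW hf cid.
  by rewrite gX /x hf /f coordE; field.
split; first exact: disk_like_of_square cf cg gf fg.
pose Q : set V := [set q | - 1 < X q < 1 /\ - 1 < Y q < 1].
pose U : set V := [set v | (w0 < W v < w1) /\ L (W v) < X v < L (W v) + D (W v)].
have gU q : Q q -> U (g q).
  move=> [Xq Yq]; have hq : w0 < h q < w1 by rewrite /h; nra.
  have hq' : w0 <= h q <= w1 by lra.
  rewrite /U /= gX gW cid //; split=> //; rewrite /x.
  by have := D0 (h q); nra.
have UT : U `<=` T by move=> v [Wv Xv]; apply/TE; split; lra.
have fU v : U v -> Q (f v).
  move=> [Wv Xv]; split; rewrite /f coordE.
    suff : 0 < (X v - L (W v)) / D (W v) < 1 by lra.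
    by rewrite ltr_pdivlMr ?ltr_pdivrMr // mul0r mul1r; lra.
  suff : 0 < (W v - w0) / (w1 - w0) < 1 by lra.
  by rewrite ltr_pdivlMr ?ltr_pdivrMr ?subr_gt0 // mul0r mul1r; lra.
have gQ : g @` Q = U.
  apply/seteqP; split=> [_ [q Qq <-]|v Uv]; first exact: gU.
  by exists (f v); [exact: fU|exact: (gf v (UT v Uv)).2].
have Q0 : Q 0 by rewrite /Q /= /X /Y !mxE; lra.
have czl (q : V) : continuous (fun s : R => s *: q) by move=> s; exact: scalel_continuous.
exists U; split=> //.
- rewrite (_ : U = [set v | w0 < W v] `&` [set v | W v < w1] `&`
      [set v | L (W v) < X v] `&` [set v | X v < L (W v) + D (W v)]); last first.
    apply/seteqP; split=> v /=; first by move=> [/andP[? ?] /andP[? ?]].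
    by move=> [[[h1 h2] h3] h4]; rewrite /U /= h1 h2 h3 h4.
  apply: openI; [apply: openI; [apply: openI|]|].
  + by apply: open_lt_continuous => //; exact: cst_continuous.
  + by apply: open_lt_continuous => //; exact: cst_continuous.
  + exact: open_lt_continuous cLW cX.
  + by apply: open_lt_continuous => // v; exact: continuous_add cLW cDW v.
- rewrite -gQ; apply: connected_continuous_connected; last exact: continuous_subspaceT.
  rewrite (_ : Q = \bigcup_(q in Q) ((fun s : R => s *: q) @` `[0, 1])).
    apply: bigcup_connected.
      by exists 0 => q _; exists 0; rewrite ?scale0r //= in_itv /= lexx ler01.
    move=> q _; apply: connected_continuous_connected.
      by apply/connected_intervalP; exact: interval_is_interval.
    exact: continuous_subspaceT.
  apply/seteqP; split=> q.
    by move=> Qq; exists q => //; exists 1; rewrite ?scale1r //= in_itv /= ler01 lexx.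
  move=> [r [Xr Yr] [s]]; rewrite /= in_itv /= => s01 <-.
  by rewrite /Q /= abscissaZ ordinateZ; nra.
- by exists (g 0); exact: gU.
- move=> v Tv B Bv.
  have [fv1 gfv] := gf v Tv.
  have : continuous (fun s : R => g (s *: f v)).
    by move=> s; exact: continuous_comp (czl (f v) s) (cg _).
  move=> /(_ 1); rewrite /continuous_at scale1r gfv => /(_ _ Bv).
  move=> /nbhs_ballP[d d0 hd].
  (* Shrink towards the centre of the square, by so little that the image stays in
   the given neighbourhood. *)
pose s := 1 - Num.min (d / 2) (1 / 2).
  have s01 : 0 < s < 1.
    rewrite /s; have : Num.min (d / 2) (1 / 2) <= 1 / 2 by rewrite ge_min lexx orbT.
    have : 0 < Num.min (d / 2) (1 / 2) by rewrite lt_min; move: d0 => /= d0; lra.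
    lra.
  exists (g (s *: f v)); split.
    apply: gU; move: fv1 => /norm_plane_le; rewrite /Q /= abscissaZ ordinateZ; nra.
  apply: hd; rewrite /ball /= /s opprB addrC subrK.
  rewrite gtr0_norm; first by rewrite gt_min; apply/orP; left; move: d0 => /=; lra.
  by move: s01; rewrite /s; lra.
Qed.

End LevelCurves.

(** * Separating the two sides of a jump *)

Section Separation.
Variable R : realType.
Local Notation V := 'cV[R]_2.
Local Notation X := (@abscissa R).
Local Notation Y := (@ordinate R).

Lemma dist_max (a b c d e : R) : `|a - c| <= e -> `|b - d| <= e ->
  `|Num.max a b - Num.max c d| <= e.
Proof.
rewrite !ler_distl => /andP[? ?] /andP[? ?].
by rewrite !maxEle; case: (leP a b); case: (leP c d) => ? ?; apply/andP; split; lra.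
Qed.

Lemma dist_min (a b c d e : R) : `|a - c| <= e -> `|b - d| <= e ->
  `|Num.min a b - Num.min c d| <= e.
Proof.
rewrite !ler_distl => /andP[? ?] /andP[? ?].
by rewrite !minEle; case: (leP a b); case: (leP c d) => ? ?; apply/andP; split; lra.
Qed.

Lemma dist_between (a b x z e : R) : `|a - z| <= e -> `|b - z| <= e ->
  a <= x <= b -> `|x - z| <= e.
Proof.
rewrite !ler_distl => /andP[? ?] /andP[? ?] /andP[? ?].
by apply/andP; split; lra.
Qed.

Lemma sgr_between (z0 z1 a b x : R) : a = z0 \/ a = z1 -> b = z0 \/ b = z1 ->
  a <= x <= b -> 0 <= Num.sg (z1 - z0) * (x - z0) <= `|z1 - z0|.
Proof.
move=> ha hb /andP[ax xb].
case: (sgrP (z1 - z0)) => h; first by rewrite mul0r lexx.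
  rewrite mul1r; case: ha => e; case: hb => e'; rewrite e e' in ax xb *; lra.
by rewrite mulN1r; case: ha => e; case: hb => e'; rewrite e e' in ax xb *; lra.
Qed.

(** This Lipschitz function climbs from 0 to 1 on both intervals [[-1/2, J - 1/2]]
    and [[1/2, J + 1/2]]: it serves the left and the right boundary curve at
    once, and needs [J < 1] to come down in between. *)
Lemma zigzag (J : R) : 0 < J < 1 -> exists (tau : R -> R) (M : R),
  [/\ 0 <= M, (forall x y, `|tau x - tau y| <= M * `|x - y|) &
   forall s u, `|s| = 1 / 2 -> 0 <= u <= J -> tau (s + u) = u / J].
Proof.
move=> /andP[J0 J1].
exists (fun x => Num.max (Num.min ((x + 1 / 2) / J) ((1 / 2 - x) / (1 - J)))
                         ((x - 1 / 2) / J)), (J^-1 + (1 - J)^-1).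
have iJ : 0 < J^-1 by rewrite invr_gt0.
have iJ1 : 0 < (1 - J)^-1 by rewrite invr_gt0 subr_gt0.
split.
- by rewrite addr_ge0 // ltW.
- move=> x y; have d0 := normr_ge0 (x - y).
  apply: dist_max; first apply: dist_min.
  + rewrite -mulrBl normrM (gtr0_norm iJ) (_ : _ + _ - _ = x - y); last by ring.
    by rewrite mulrC ler_wpM2r // lerDl ltW.
  + rewrite -mulrBl normrM (gtr0_norm iJ1) (_ : _ - _ - _ = y - x); last by ring.
    by rewrite (distrC y) mulrC ler_wpM2r // lerDr ltW.
  + rewrite -mulrBl normrM (gtr0_norm iJ) (_ : _ - _ - _ = x - y); last by ring.
    by rewrite mulrC ler_wpM2r // lerDl ltW.
- move=> s u hs /andP[u0 uJ].
  have uJ1 : u / J <= 1 by rewrite ler_pdivrMr // mul1r.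
  have uJ0 : 0 <= u / J by rewrite divr_ge0 // ltW.
  have [->|->] : s = 1 / 2 \/ s = - (1 / 2) by move: hs; case: (ger0P s) => _ ?; [left|right]; lra.
  + rewrite (_ : 1 / 2 + u - 1 / 2 = u); last by ring.
    apply: max_r; apply: le_trans uJ0; rewrite ge_min; apply/orP; right.
    rewrite (_ : 1 / 2 - _ = - u); last by ring.
    by rewrite mulNr oppr_le0 divr_ge0 // subr_ge0 ltW.
  + rewrite (_ : - (1 / 2) + u + 1 / 2 = u); last by ring.
    rewrite (_ : 1 / 2 - _ = 1 - u); last by field.
    rewrite (_ : - (1 / 2) + u - 1 / 2 = u - 1); last by field.
    rewrite min_l; last first.
      apply: le_trans uJ1 _; rewrite ler_pdivlMr ?subr_gt0 // mul1r; lra.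
    apply: max_l; rewrite ler_wpM2r ?ltW //; lra.
Qed.

(** The linear rate is what lets a multiple of [y - y0] dominate the variation of
    the curve near the jump.  A jump smaller than 1 keeps apart the boundaries
    of the thickened set. *)
Definition jump (G : set V) (y0 z0 z1 : R) : Prop :=
  [/\ `|y0| < 1 / 2, 0 < `|z1 - z0| < 1 & exists C : R, forall g, G g ->
    [/\ Y g < y0 -> `|X g - z0| <= C * (y0 - Y g),
        y0 < Y g -> `|X g - z1| <= C * (Y g - y0) &
        Y g = y0 -> X g = z0 \/ X g = z1]].

(** A boundary curve of the thickened set, for [s = - 1 / 2] or [s = 1 / 2].  The
    jumps are filled so that the curve separates its two sides. *)
Definition shifted_curve (G : set V) (s : R) : set V :=
  [set v | exists g g', [/\ G g, G g', Y g = Y v, Y g' = Y v &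
                            X g <= X v - s <= X g']].

(** Take for [psi] the truncation to [[0, 1]] of [rho (x) + K * (y - y0)], where
    [rho] is 0 at [z0 + s], 1 at [z1 + s] and Lipschitz.  The curves approach
    these points at a linear rate, so for large [K] the second term wins off the
    horizontal line [y = y0], and [psi] is 0 below and 1 above; on that line
    [psi = rho] tells the points of a segment apart. *)
Lemma jump_separation (G : set V) (y0 z0 z1 : R) : jump G y0 z0 z1 ->
  exists psi : V -> R,
  [/\ continuous psi /\ (forall v, 0 <= psi v <= 1),
      forall v w, X v = X w -> Y v <= Y w -> psi v <= psi w,
      forall v, (Y v <= - (1 / 2) -> psi v = 0) /\ (1 / 2 <= Y v -> psi v = 1),
      forall s v, `|s| = 1 / 2 -> shifted_curve G s v ->
        (Y v < y0 -> psi v = 0) /\ (y0 < Y v -> psi v = 1) &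
      forall s v w, `|s| = 1 / 2 -> shifted_curve G s v -> shifted_curve G s w ->
        Y v = y0 -> Y w = y0 -> psi v = psi w -> X v = X w].
Proof.
case=> y01 Jin [C hC].
pose J := `|z1 - z0|; pose sg := Num.sg (z1 - z0).
have [tau [M [M0 tauM tauE]]] := @zigzag J Jin.
move: Jin => /andP[J0 J1].
have dz : z1 - z0 != 0 by rewrite -normr_gt0.
have sg2 : `|sg| = 1 by rewrite /sg normr_sg dz.
have sgJ : sg * (z1 - z0) = J by rewrite /sg /J -normrEsg.
have sgsg : sg * sg = 1 by rewrite -expr2 /sg sqr_sg dz.
pose rho x := tau (sg * (x - z0)).
have rhoM x y : `|rho x - rho y| <= M * `|x - y|.
  apply: le_trans (tauM _ _) _; rewrite -mulrBr normrM sg2 mul1r.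
  by rewrite (_ : x - z0 - _ = x - y) //; ring.
have rho_seg s u : `|s| = 1 / 2 -> 0 <= u <= J -> rho (z0 + s + sg * u) = u / J.
  move=> hs hu; have hs' : `|sg * s| = 1 / 2 by rewrite normrM sg2 hs !mul1r.
  rewrite /rho -(tauE (sg * s) u hs' hu); congr (tau _).
  have -> : z0 + s + sg * u - z0 = s + sg * u by ring.
  by rewrite mulrDr mulrA sgsg mul1r.
have rho0 s : `|s| = 1 / 2 -> rho (z0 + s) = 0.
  move=> hs; have := @rho_seg s 0 hs; rewrite mulr0 addr0 mul0r; apply.
  by rewrite lexx ltW.
have z1E : z0 + sg * J = z1.
  by rewrite -sgJ mulrA sgsg mul1r; ring.
have rho1 s : `|s| = 1 / 2 -> rho (z1 + s) = 1.
  move=> hs; have := @rho_seg s J hs; rewrite divff ?gt_eqF //.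
  by rewrite -addrA (addrC s) addrA z1E; apply; rewrite lexx ltW.
have tauc : continuous tau.
  apply: continuous_of_dist => x e e0.
  have M1 : 0 < M + 1 by rewrite ltr_wpDl.
  apply/nbhs_ballP; exists (e / (M + 1)); first by rewrite /= divr_gt0.
  move=> y; rewrite /ball /= ltr_pdivlMr // => xy.
  apply: le_lt_trans (tauM _ _) _; apply: le_lt_trans xy.
  by rewrite mulrC ler_wpM2l // lerDl.
have rhoc : continuous rho.
  apply: (continuous_after _ tauc); apply: continuous_mul; first exact: continuous_const.
  by apply: continuous_sub; [move=> ?; exact: cvg_id|exact: continuous_const].
pose c01 := @clamp R 0 1.
have c01c : continuous c01 by exact: continuous_clamp.
have c01I x : 0 <= c01 x <= 1 by exact: clamp_bounds.
have c01_id x : 0 <= x <= 1 -> c01 x = x by exact: clamp_id.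
have c01_mono x y : x <= y -> c01 x <= c01 y by exact: clamp_mono.
have c01_0 x : x <= 0 -> c01 x = 0.
  by move=> h; rewrite /c01 /clamp (min_idPr (le_trans h ler01)) (max_idPl h).
have c01_1 x : 1 <= x -> c01 x = 1.
  by move=> h; rewrite /c01 /clamp (min_idPl h) (max_idPr ler01).
have c01_lt x e : x <= e -> 0 <= e -> c01 x <= e.
  by move=> h he; rewrite /c01 /clamp ge_max he ge_min h orbT.
have c01_gt x e : 1 - e <= x -> 0 <= e -> 1 - e <= c01 x.
  by move=> h he; rewrite /c01 /clamp le_max; apply/orP; right; rewrite le_min h andbT; lra.
(* The first summand beats the variation of [rho] along the curves, the second
   makes the truncated function constant outside the strip. *)
pose K := M * `|C| + (1 / 2 - `|y0|)^-1.
have i0 : 0 < (1 / 2 - `|y0|)^-1 by rewrite invr_gt0 subr_gt0.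
have MC0 : 0 <= M * `|C| by rewrite mulr_ge0.
have K0 : 0 <= K by rewrite /K; lra.
have KMC d : 0 <= d -> M * `|C| * d <= K * d.
  by move=> d0; rewrite ler_wpM2r // /K lerDl ltW.
have K1 d : 1 / 2 - `|y0| <= d -> 1 <= K * d.
  move=> hd; have d0 : 0 < 1 / 2 - `|y0| by rewrite subr_gt0.
  have : (1 / 2 - `|y0|)^-1 * d <= K * d by rewrite ler_wpM2r /K; lra.
  by apply: le_trans; rewrite ler_pdivlMl // mulr1.
have [yl yr] : y0 <= `|y0| /\ - y0 <= `|y0|.
  by split; [exact: ler_norm|rewrite -normrN; exact: ler_norm].
have near_rho (z x r s : R) : `|x - s - z| <= C * r -> 0 <= r ->
    `|rho x - rho (z + s)| <= K * r.
  move=> hx r0; apply: le_trans (rhoM _ _) _; apply: le_trans (KMC r r0).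
  rewrite -mulrA ler_wpM2l // (_ : x - (z + s) = x - s - z); last by ring.
  by apply: le_trans hx _; rewrite ler_wpM2r // ler_norm.
pose psi (v : V) := c01 (c01 (rho (X v)) + K * (Y v - y0)).
exists psi; rewrite /psi; split.
- split; last by move=> v; exact: c01I.
  have cX := @continuous_abscissa R; have cY := @continuous_ordinate R.
  apply: (continuous_after _ c01c); apply: continuous_add.
    exact: (continuous_after (continuous_after cX rhoc) c01c).
  apply: continuous_mul; first exact: continuous_const.
  by apply: continuous_sub => //; exact: continuous_const.
- by move=> v w -> vw; apply: c01_mono; rewrite lerD2l ler_wpM2l // lerD2r.
- move=> v; have /andP[r0 r1] := c01I (rho (X v)); split=> hv.
    apply: c01_0; have : 1 <= K * (y0 - Y v) by apply: K1; lra.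
    by lra.
  apply: c01_1; have : 1 <= K * (Y v - y0) by apply: K1; lra.
  by lra.
- move=> s v hs [g [g' [Gg Gg' Yg Yg' gg']]]; split=> hv.
    have [h1 _ _] := hC g Gg; have [h1' _ _] := hC g' Gg'.
    rewrite Yg in h1; rewrite Yg' in h1'.
    have d0 : 0 <= y0 - Y v by lra.
    have := near_rho z0 (X v) _ s (dist_between (h1 hv) (h1' hv) gg') d0.
    rewrite rho0 // subr0 => /(le_trans (ler_norm _)) hr.
    apply: c01_0; have := c01_lt _ _ hr (mulr_ge0 K0 d0); lra.
  have [_ h1 _] := hC g Gg; have [_ h1' _] := hC g' Gg'.
  rewrite Yg in h1; rewrite Yg' in h1'.
  have d0 : 0 <= Y v - y0 by lra.
  have := near_rho z1 (X v) _ s (dist_between (h1 hv) (h1' hv) gg') d0.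
  rewrite rho1 // ler_distl => /andP[hr _].
  apply: c01_1; have := c01_gt _ _ hr (mulr_ge0 K0 d0); lra.
- move=> s v w hs Lv Lw Yv Yw.
  have param u : shifted_curve G s u -> Y u = y0 ->
      exists2 t, 0 <= t <= J & X u = z0 + s + sg * t.
    move=> [g [g' [Gg Gg' Yg Yg' gg']]] Yu; exists (sg * (X u - s - z0)); last first.
      by rewrite mulrA sgsg mul1r; ring.
    have [_ _ /(_ (etrans Yg Yu)) hg] := hC g Gg.
    have [_ _ /(_ (etrans Yg' Yu)) hg'] := hC g' Gg'.
    exact: (sgr_between hg hg' gg').
  have [t t01 vE] := param v Lv Yv; have [t' t01' wE] := param w Lw Yw.
  have iJ1 q : 0 <= q <= J -> 0 <= q / J <= 1.
    by move=> /andP[? ?]; rewrite divr_ge0 ?(ltW J0) //= ler_pdivrMr // mul1r.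
  rewrite Yv Yw subrr mulr0 !addr0 vE wE !rho_seg // !(c01_id _ (iJ1 _ _)) //.
  by move/(divIf (lt0r_neq0 J0)) ->.
Qed.
End Separation.

(** * A height that is injective on the boundary curves *)

Section DyadicSums.
Variables (R : realType) (T : Type) (psi : nat -> T -> R).
Hypothesis psi01 : forall n v, 0 <= psi n v <= 1.

Definition dyadic_partial (v : T) (N : nat) : R := \sum_(n < N) psi n v / 2 ^+ n.+1.
(** The sum of the series; with nonnegative terms it is a supremum of partial
    sums, which makes comparisons immediate. *)
Definition dyadic_sum (v : T) : R := sup (range (dyadic_partial v)).

Let weight_gt0 n : 0 < (2 ^+ n)^-1 :> R.
Proof. by rewrite invr_gt0 exprn_gt0. Qed.

Lemma dyadic_partialS v N :
  dyadic_partial v N.+1 = dyadic_partial v N + psi N v / 2 ^+ N.+1.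
Proof. by rewrite /dyadic_partial big_ord_recr. Qed.

Lemma dyadic_partial_le v N M : (N <= M)%N -> dyadic_partial v N <= dyadic_partial v M.
Proof.
elim: M => [|M IH]; first by rewrite leqn0 => /eqP ->.
rewrite leq_eqVlt => /predU1P[->//|]; rewrite ltnS => /IH h.
apply: le_trans h _; rewrite dyadic_partialS lerDl mulr_ge0 ?(ltW (weight_gt0 _)) //.
by case/andP: (psi01 M v).
Qed.

Lemma dyadic_partial_tail v N M :
  dyadic_partial v M <= dyadic_partial v N + (2 ^+ N)^-1.
Proof.
have [MN|/ltnW NM] := leqP M N.
  by apply: le_trans (dyadic_partial_le v MN) _; rewrite lerDl ltW.
suff : dyadic_partial v M + (2 ^+ M)^-1 <= dyadic_partial v N + (2 ^+ N)^-1.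
  by apply: le_trans; rewrite lerDl ltW.
elim: M NM => [|M IH]; first by rewrite leqn0 => /eqP ->.
rewrite leq_eqVlt => /predU1P[->//|]; rewrite ltnS => /IH; apply: le_trans.
rewrite dyadic_partialS exprS invfM -addrA lerD2l.
have := weight_gt0 M; have /andP[_ p1] := psi01 M v => w0.
have : psi M v * (2^-1 * (2 ^+ M)^-1) <= 2^-1 * (2 ^+ M)^-1.
  by rewrite ler_piMl // mulr_ge0 ?invr_ge0 ?ltW.
by lra.
Qed.

Lemma dyadic_sum_ge v N : dyadic_partial v N <= dyadic_sum v.
Proof.
apply: ub_le_sup; last by exists N.
by exists (dyadic_partial v 0 + (2 ^+ 0)^-1) => _ [M _ <-]; exact: dyadic_partial_tail.
Qed.

Lemma dyadic_sum_le v e : (forall N, dyadic_partial v N <= e) -> dyadic_sum v <= e.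
Proof.
by move=> h; apply: ge_sup; [exists (dyadic_partial v 0); exists 0|move=> _ [N _ <-]].
Qed.

Lemma dyadic_sum01 v : 0 <= dyadic_sum v <= 1.
Proof.
apply/andP; split.
  by apply: le_trans (dyadic_sum_ge v 0); rewrite /dyadic_partial big_ord0.
apply: dyadic_sum_le => N; have := dyadic_partial_tail v 0 N.
by rewrite /dyadic_partial big_ord0 add0r expr0 invr1.
Qed.

Lemma dyadic_sum_mono v w : (forall n, psi n v <= psi n w) ->
  dyadic_sum v <= dyadic_sum w.
Proof.
move=> h; apply: dyadic_sum_le => N; apply: le_trans (dyadic_sum_ge w N).
by apply: ler_sum => n _; rewrite ler_wpM2r // ltW.
Qed.

(** The difference of the [k]-th terms bounds the difference of the sums from
    below. *)
Lemma dyadic_sum_lt v w k : (forall n, psi n v <= psi n w) -> psi k v < psi k w ->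
  dyadic_sum v < dyadic_sum w.
Proof.
move=> h hk; pose d := (psi k w - psi k v) / 2 ^+ k.+1.
have d0 : 0 < d by rewrite mulr_gt0 ?subr_gt0.
suff : dyadic_sum v <= dyadic_sum w - d by move=> h'; lra.
apply: dyadic_sum_le => N; pose M := maxn N k.+1.
apply: le_trans (dyadic_partial_le v (leq_maxl N k.+1)) _; rewrite -/M.
rewrite lerBrDr; apply: le_trans (dyadic_sum_ge w M).
have kM : (k < M)%N by exact: leq_maxr.
rewrite /dyadic_partial [leRHS](bigD1 (Ordinal kM)) //= (bigD1 (Ordinal kM)) //= addrAC /d -mulrDl subrKC.
rewrite lerD2l; apply: ler_sum => n _; rewrite ler_wpM2r // ltW //.
Qed.

End DyadicSums.

Lemma continuous_dyadic_sum (R : realType) (T : topologicalType) (psi : nat -> T -> R) :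
  (forall n v, 0 <= psi n v <= 1) -> (forall n, continuous (psi n)) ->
  continuous (dyadic_sum psi).
Proof.
move=> psi01 cpsi; apply: continuous_of_dist => t e e0.
have [N hN] : exists N, (2 ^+ N)^-1 < e / 3 :> R.
  have e3 : 0 < e / 3 by rewrite divr_gt0.
  have /cvgrPdist_lt/(_ _ e3) := @cvg_geometric R 1 (2^-1) ltac:(by rewrite gtr0_norm; lra).
  move=> [N _ /(_ N (leqnn N))] /=.
  rewrite /geometric /= mul1r sub0r normrN gtr0_norm ?exprn_gt0 ?invr_gt0 // exprVn => ?.
  by exists N.
have cN : continuous (fun v => dyadic_partial psi v N).
  elim: N {hN} => [|N IH].
    rewrite (_ : (fun _ => _) = fun=> 0); first exact: continuous_const.
    by apply/funext => v; rewrite /dyadic_partial big_ord0.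
  rewrite (_ : (fun _ => _) = fun v => dyadic_partial psi v N + psi N v / 2 ^+ N.+1).
    apply: continuous_add => //; apply: continuous_mul => //; exact: continuous_const.
  by apply/funext => v; rewrite dyadic_partialS.
have tail v : dyadic_partial psi v N <= dyadic_sum psi v <= dyadic_partial psi v N + e / 3.
  rewrite dyadic_sum_ge //=; apply: dyadic_sum_le => M.
  by apply: le_trans (dyadic_partial_tail psi01 v N M) _; rewrite lerD2l ltW.
have e3 : 0 < e / 3 by rewrite divr_gt0.
have /cvgrPdist_lt/(_ _ e3) := cN t.
apply: filterS => u; rewrite !ltr_distl.
by have := tail t; have := tail u => /andP[? ?] /andP[? ?] /andP[? ?]; apply/andP; split; lra.
Qed.

Section HeightOfCurve.
Variable R : realType.
Local Notation V := 'cV[R]_2.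
Local Notation X := (@abscissa R).
Local Notation Y := (@ordinate R).

(** The height adds to the ordinate one function from jump_separation for each
    jump, with dyadic weights.  Each of these is nondecreasing along the curves
    when the ordinate increases, and on one horizontal line only those of the
    jump at that line vary.  The jumps are indexed by the rationals, which are
    countable. *)
Lemma curve_height (G : set V) :
  (forall g g', G g -> G g' -> Y g = Y g' -> X g <> X g' ->
    (exists z0 z1, jump G (Y g) z0 z1) /\ exists q : rat, Y g = ratr q) ->
  exists (W : V -> R) (w0 w1 : R), height_function W w0 w1 /\
    forall s v w, `|s| = 1 / 2 -> shifted_curve G s v -> shifted_curve G s w ->
      W v = W w -> v = w.
Proof.
move=> hG.
(* The pair consists of the function of the jump at [y0] and of its top value,
   both 0 when there is no jump.  It depends on the height [y0] only: a height
   with several codes must always get the same function, or two copies with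
   opposite orientations could cancel. *)
have fam y0 : exists pc : (V -> R) * R, let psi := pc.1 in let c := pc.2 in
  [/\ continuous psi /\ (c <= 1 /\ forall v, 0 <= psi v <= c),
      forall v w, X v = X w -> Y v <= Y w -> psi v <= psi w,
      forall v, (Y v <= - (1 / 2) -> psi v = 0) /\ (1 / 2 <= Y v -> psi v = c),
      forall s v, `|s| = 1 / 2 -> shifted_curve G s v ->
        (Y v < y0 -> psi v = 0) /\ (y0 < Y v -> psi v = c) &
      forall s v w z0 z1, `|s| = 1 / 2 -> jump G y0 z0 z1 ->
        shifted_curve G s v -> shifted_curve G s w ->
        Y v = y0 -> Y w = y0 -> psi v = psi w -> X v = X w].
  have [[z0 [z1 hj]]|nj] := pselect (exists z0 z1, jump G y0 z0 z1).
    have [psi [[c1 c2] p2 p3 p4 p5]] := jump_separation hj.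
    by exists (psi, 1); split=> // s v w _ _ hs _; exact: p5.
  exists (fun=> 0, 0); split=> //=.
  - by split; [exact: continuous_const|split=> // v; rewrite lexx].
  - by move=> s v w z0 z1 _ hj; case: nj; exists z0, z1.
have [F hF] := choice fam.
pose at_ n : option R := omap (fun q : rat => ratr q) (unpickle n).
pose psi n : V -> R := if at_ n is Some y then (F y).1 else fun=> 0.
pose c n : R := if at_ n is Some y then (F y).2 else 0.
have psic n : continuous (psi n).
  by rewrite /psi; case: (at_ n) => [y|]; [case: (hF y) => -[]|exact: continuous_const].
have psile n v : 0 <= psi n v <= c n.
  by rewrite /psi /c; case: (at_ n) => [y|]; [case: (hF y) => -[_ [_]]|rewrite lexx].
have psi01 n v : 0 <= psi n v <= 1.
  have /andP[-> /= h] := psile n v; apply: le_trans h _.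
  by rewrite /c; case: (at_ n) => [y|//]; case: (hF y) => -[_ []].
have psi_mono n v w : X v = X w -> Y v <= Y w -> psi n v <= psi n w.
  by rewrite /psi; case: (at_ n) => [y|//]; case: (hF y) => _ + _ _ _; apply.
have psi_edge n v : (Y v <= - (1 / 2) -> psi n v = 0) /\ (1 / 2 <= Y v -> psi n v = c n).
  by rewrite /psi /c; case: (at_ n) => [y|//]; case: (hF y).
have congS v w : (forall n, psi n v = psi n w) -> dyadic_sum psi v = dyadic_sum psi w.
  by move=> h; apply: le_anti; rewrite !dyadic_sum_mono // => n; rewrite h.
exists (fun v => Y v + dyadic_sum psi v), (- (1 / 2) + dyadic_sum psi (vec2 0 (- (1 / 2)))),
  (1 / 2 + dyadic_sum psi (vec2 0 (1 / 2))).
split; first split.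
- apply: continuous_add; first exact: continuous_ordinate.
  exact: continuous_dyadic_sum.
- move=> v w vw Yvw; apply: ltr_leD => //.
  by apply: dyadic_sum_mono => // n; apply: psi_mono => //; exact: ltW.
- by move=> v; have := dyadic_sum01 psi01 v; lra.
- move=> v Yv; rewrite Yv; congr (_ + _); apply: congS => n.
  by rewrite !(psi_edge n _).1 ?coordE // Yv.
- move=> v Yv; rewrite Yv; congr (_ + _); apply: congS => n.
  by rewrite !(psi_edge n _).2 ?coordE // Yv.
move=> s v w hs Lv Lw /= Wvw.
have psi_curve n y u : at_ n = Some y -> shifted_curve G s u ->
    (Y u < y -> psi n u = 0) /\ (y < Y u -> psi n u = c n).
  by rewrite /psi /c => -> Lu; case: (hF y) => _ _ _ h _; exact: h hs Lu.
have Ylt u u' : shifted_curve G s u -> shifted_curve G s u' -> Y u < Y u' ->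
    Y u + dyadic_sum psi u < Y u' + dyadic_sum psi u'.
  move=> Lu Lu' uu'; apply: ltr_leD => //; apply: dyadic_sum_mono => // n.
  case E : (at_ n) => [y|]; last by rewrite /psi E.
  have [uy|yu] := ltP (Y u) y.
    by rewrite ((psi_curve n y u E Lu).1 uy); case/andP: (psile n u').
  rewrite ((psi_curve n y u' E Lu').2 (le_lt_trans yu uu')).
  by case/andP: (psile n u).
have Yvw : Y v = Y w.
  case: (ltgtP (Y v) (Y w)) => // h.
  - by have := Ylt _ _ Lv Lw h; rewrite Wvw ltxx.
  - by have := Ylt _ _ Lw Lv h; rewrite Wvw ltxx.
apply: vec2_eq => //; apply: contrapT => Xvw.
have [[z0 [z1 hj]] [q hq]] : (exists z0 z1, jump G (Y v) z0 z1) /\ exists q : rat, Y v = ratr q.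
  have [g [g' [Gg Gg' Yg Yg' gg']]] := Lv; have [k [k' [Gk Gk' Yk Yk' kk']]] := Lw.
  have [e1|n1] := eqVneq (X g) (X g'); last first.
    by rewrite -Yg; apply: (hG g g') => //; [rewrite Yg|exact/eqP].
  have [e2|n2] := eqVneq (X k) (X k'); last first.
    by rewrite Yvw -Yk; apply: (hG k k') => //; [rewrite Yk|exact/eqP].
  rewrite -Yg; apply: (hG g k) => //; first by rewrite Yg Yvw.
  by move=> e3; apply: Xvw; move: gg' kk' => /andP[? ?] /andP[? ?]; lra.
(* All functions of the jump at this height coincide, so none of them can
   compensate for the strict increase of the one with index [pickle q]. *)
have key u u' : shifted_curve G s u -> shifted_curve G s u' -> Y u = Y v -> Y u' = Y v ->
    (F (Y v)).1 u < (F (Y v)).1 u' -> dyadic_sum psi u < dyadic_sum psi u'.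
  move=> Lu Lu' Yu Yu' hlt; apply: (@dyadic_sum_lt _ _ psi psi01 u u' (pickle q)).
    move=> n; case E : (at_ n) => [y|]; last by rewrite /psi E.
    case: (ltgtP (Y v) y) => hy.
    + rewrite (psi_curve n y u E Lu).1 ?Yu //.
      by case/andP: (psile n u').
    + rewrite (psi_curve n y u' E Lu').2 ?Yu' //.
      by case/andP: (psile n u).
    + by rewrite /psi E -hy ltW.
  by rewrite /psi /at_ pickleK /= -hq.
have Svw : dyadic_sum psi v = dyadic_sum psi w by apply: (addrI (Y v)); rewrite Wvw Yvw.
case: (ltgtP ((F (Y v)).1 v) ((F (Y v)).1 w)) => h.
- by have := key _ _ Lv Lw erefl (esym Yvw) h; rewrite Svw ltxx.
- by have := key _ _ Lw Lv (esym Yvw) erefl h; rewrite Svw ltxx.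
- apply: Xvw; case: (hF (Y v)) => _ _ _ _ inj.
  exact: (inj s v w z0 z1).
Qed.
End HeightOfCurve.

(** * The digit graph *)

Section Digits.
Variables (R : realType) (m : nat).

Definition digit_range : set int := [set j : int | `|j| <= m%:Z].

Lemma digit_le j : digit_range j -> `|j%:~R : R| <= m%:R.
Proof. by rewrite /digit_range /= -intr_norm => hj; rewrite pmulrn ler_int. Qed.

Lemma extreme_digit j : digit_range j -> m%:Z <= `|j| -> j = m%:Z \/ j = - m%:Z.
Proof. by rewrite /digit_range /=; lia. Qed.

Lemma card_digit_range : (digit_range #= `I_(2 * m + 1))%card.
Proof.
have -> : digit_range = (fun k : nat => k%:Z - m%:Z) @` `I_(2 * m + 1).
  apply/seteqP; split=> [j|_ [k /= hk <-]]; rewrite /digit_range /=; last lia.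
  by move=> hj; exists `|(j + m%:Z)%R|%N; rewrite /=; lia.
by apply: inj_card_eq => x y _ _ /addIr [].
Qed.

Lemma finite_digit_range : finite_set digit_range.
Proof. by apply/finite_setP; exists (2 * m + 1)%N; exact: card_digit_range. Qed.

Lemma digit_near (t : R) : `|t| <= m%:R + 1 / 2 ->
  exists2 j, digit_range j & `|t - j%:~R| <= 1 / 2.
Proof.
move=> ht; pose k := Num.floor (t + 1 / 2).
have /andP[k1 k2] := floor_itv (t + 1 / 2).
rewrite -/k intrD in k1 k2.
move: ht; rewrite ler_norml => /andP[h1 h2].
have mR : m%:R = m%:Z%:~R :> R by rewrite -pmulrn.
have [km|km] := leP k m%:Z.
  exists k; last by rewrite ler_distl; lra.
  rewrite /digit_range /= ler_norml km andbT lerNl -ltzD1 ltrNl -(ltr_int R) intrN intrD -mR.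
  by lra.
have : (m%:Z + 1)%:~R <= k%:~R :> R by rewrite ler_int lezD1.
rewrite intrD -mR => km'.
exists m%:Z; first by rewrite /digit_range /=; lia.
by rewrite ler_distl -mR; lra.
Qed.

End Digits.

Section DigitGraph.
Variables (R : realType) (p : int) (m : nat).
Hypotheses (hm : (1 <= m)%N) (hp : `|p| = (2 * m + 1)%N%:Z).
Local Notation V := 'cV[R]_2.
Local Notation X := (@abscissa R).
Local Notation Y := (@ordinate R).
Local Notation P := (p%:~R : R).

(** The parity of [j] as a real number; it is [digit_shift 1 j]. *)
Definition odd_part (j : int) : R := (1 - (-1) ^ j) / 2.
Local Notation beta := odd_part.
Local Notation digit_range := (digit_range m).

Lemma base_norm : `|P| = 2 * m%:R + 1.
Proof. by rewrite -intr_norm hp /= -pmulrn natrD natrM. Qed.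

Lemma base_ge3 : 3 <= `|P|.
Proof. have : (1 : R) <= m%:R by rewrite ler1n. by rewrite base_norm; lra. Qed.

Lemma base_neq0 : P != 0.
Proof. by rewrite -normr_gt0; have := base_ge3; lra. Qed.

Lemma odd_part_sign j : beta j = 0 /\ (-1 : R) ^ j = 1 \/ beta j = 1 /\ (-1 : R) ^ j = - 1.
Proof.
rewrite /beta expN1r -signr_odd; case: odd; rewrite ?expr0 ?expr1; [right|left]; split=> //; lra.
Qed.

Lemma odd_part01 j : 0 <= beta j <= 1.
Proof. by case: (odd_part_sign j) => -[-> _]; rewrite ?lexx ler01. Qed.

Lemma odd_partN j : beta (- j) = beta j.
Proof. by rewrite /beta !expN1r abszN. Qed.

Lemma odd_part_succ j : `|beta (j + 1) - beta j| = 1.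
Proof.
rewrite {1}/beta expfzDr ?oppr_eq0 ?oner_eq0 // expr1z.
case: (odd_part_sign j) => -[-> ->].
  by rewrite (_ : _ - _ = 1) ?normr1 //; lra.
by rewrite (_ : _ - _ = - 1) ?normrN1 //; lra.
Qed.

Definition branch (j : int) (v : V) : V :=
  vec2 ((X v + beta j) / P) ((Y v + j%:~R) / P).

Definition unbranch (j : int) (v : V) : V :=
  vec2 (P * X v - beta j) (P * Y v - j%:~R).

Lemma branchK j : cancel (branch j) (unbranch j).
Proof. by move=> v; apply: vec2_eq; rewrite /unbranch /branch !coordE; field; exact: base_neq0. Qed.

Lemma unbranchK j : cancel (unbranch j) (branch j).
Proof. by move=> v; apply: vec2_eq; rewrite /unbranch /branch !coordE; field; exact: base_neq0. Qed.

Lemma continuous_affine_map (a b c d : R) :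
  continuous (fun v : V => vec2 (a * X v + b) (c * Y v + d)).
Proof.
have cX := @continuous_abscissa R; have cY := @continuous_ordinate R.
by apply: continuous_vec2; apply: continuous_add; try exact: continuous_const;
  apply: continuous_mul => //; exact: continuous_const.
Qed.

Lemma continuous_branch j : continuous (branch j).
Proof.
rewrite (_ : branch j = fun v => vec2 (P^-1 * X v + beta j / P) (P^-1 * Y v + j%:~R / P)).
  exact: continuous_affine_map.
by apply/funext => v; rewrite /branch !mulrDl !(mulrC P^-1).
Qed.

Lemma continuous_unbranch j : continuous (unbranch j).
Proof. exact: continuous_affine_map. Qed.

Definition box : set V := [set v | `|X v| <= 1 /\ `|Y v| <= 1 / 2].

Lemma closed_box : closed box.
Proof.
rewrite (_ : box = [set v | `|X v| <= 1] `&` [set v | `|Y v| <= 1 / 2]) //.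
have cX := @continuous_abscissa R; have cY := @continuous_ordinate R.
have cn : continuous (fun x : R => `|x|) by exact: norm_continuous.
by apply: closedI; apply: closed_le_continuous; try exact: continuous_const;
  [exact: (continuous_after cX cn)|exact: (continuous_after cY cn)].
Qed.

Lemma compact_box : compact box.
Proof.
rewrite (_ : box = (fun q : R * R => vec2 q.1 q.2) @`
    (`[(-1), 1]%classic `*` `[(- (1 / 2)), (1 / 2)]%classic)).
  apply: continuous_compact.
    apply: continuous_subspaceT; apply: continuous_vec2.
      by move=> q; exact: cvg_fst.
    by move=> q; exact: cvg_snd.
  by apply: compact_setX; exact: segment_compact.
apply/seteqP; split=> [v [Xv Yv]|_ [q [/= h1 h2] <-]].
  by exists (X v, Y v); rewrite ?vec2_surj //= !in_itv /= -!ler_norml.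
by rewrite /box /= !coordE !ler_norml; move: h1 h2; rewrite !in_itv.
Qed.

(** Points that can be expanded forever by the inverse branches inside the box.
    Invariance under the branches is immediate for this set, and passes to its
    closure because there are finitely many branches, all homeomorphisms. *)
Definition orbit_points : set V := [set v | exists (u : nat -> V) (d : nat -> int),
  u 0%N = v /\ forall n, [/\ digit_range (d n), box (u n) & u n = branch (d n) (u n.+1)]].

Definition digit_graph : set V := closure orbit_points.

Lemma branch_box j v : digit_range j -> box v -> box (branch j v).
Proof.
move=> /(digit_le R) hj [Xv Yv]; rewrite /box /= /branch !coordE !normrM !normfV.
have P3 := base_ge3; have P0 : 0 < `|P| by lra.
rewrite !ler_pdivrMr //; have /andP[b0 b1] := odd_part01 j; split.
  by apply: le_trans (ler_normD _ _) _; rewrite (ger0_norm b0); lra.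
by apply: le_trans (ler_normD _ _) _; rewrite base_norm; lra.
Qed.

Lemma orbit_points_fixed : orbit_points = \bigcup_(j in digit_range) (branch j @` orbit_points).
Proof.
apply/seteqP; split=> [v [u [d [<- hu]]]|_ [j hj [v [u [d [<- hu]]] <-]]].
  have [d0 _ u0] := hu 0%N; exists (d 0%N) => //; exists (u 1%N) => //.
  by exists (fun n => u n.+1), (fun n => d n.+1).
exists (fun n => if n is k.+1 then u k else branch j (u 0%N)),
  (fun n => if n is k.+1 then d k else j); split=> // -[|n] /=; last by have [? ? ?] := hu n.
by split=> //; apply: branch_box => //; have [] := hu 0%N.
Qed.

Lemma digit_graph_box : digit_graph `<=` box.
Proof.
rewrite [X in _ `<=` X](closure_id _).1; last exact: closed_box.
by apply: closureS => v [u [d [<- /(_ 0%N)[]]]].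
Qed.

Lemma compact_digit_graph : compact digit_graph.
Proof.
apply: subclosed_compact compact_box digit_graph_box.
exact: closed_closure.
Qed.

Lemma digit_graph0 : digit_graph 0.
Proof.
apply: subset_closure; exists (fun=> 0), (fun=> 0); split=> // n; split.
- by rewrite /digit_range /= normr0.
- by rewrite /box /= /X /Y !mxE normr0; lra.
- apply: vec2_eq; rewrite /branch coordE /X /Y !mxE ?add0r ?mul0r //.
  by rewrite /beta expr0z subrr !mul0r.
Qed.

Lemma digit_graph_fixed : digit_graph = \bigcup_(j in digit_range) (branch j @` digit_graph).
Proof.
have clb j : branch j @` digit_graph = closure (branch j @` orbit_points).
  by rewrite (closure_homeo (@continuous_branch j) (@continuous_unbranch j)
    (branchK j) (unbranchK j)).
apply/seteqP; split=> [|v [j hj vj]].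
  rewrite [X in _ `<=` X](closure_id _).1.
    rewrite {1}/digit_graph {1}orbit_points_fixed; apply: closureS.
    move=> v [j hj [w hw <-]]; exists j => //; exists w => //; exact: subset_closure.
  apply: closed_bigcup (finite_digit_range m) _ => j _; rewrite clb; exact: closed_closure.
rewrite clb in vj; move: v vj; apply: closureS; rewrite [X in _ `<=` X]orbit_points_fixed.
by move=> w hw; exists j.
Qed.

Local Notation G := digit_graph.

Lemma digit_graph_step g : G g -> exists2 j, digit_range j & exists2 g', G g' &
  P * X g = X g' + beta j /\ P * Y g = Y g' + j%:~R.
Proof.
rewrite {1}digit_graph_fixed => -[j hj [g' Gg' <-]]; exists j => //; exists g' => //.
by rewrite /branch !coordE ![P * _]mulrC !divfK ?base_neq0.
Qed.

Lemma digit_graph_branch j g : digit_range j -> G g -> G (branch j g).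
Proof. by move=> hj Gg; rewrite digit_graph_fixed; exists j => //; exists g. Qed.

(** Powers of the base eventually beat every constant; this turns the
    estimates that lose a geometric error at each step into exact ones. *)
Lemma geometric_small (B e : R) : 0 < e -> exists n : nat, B / `|P| ^+ n < e.
Proof.
move=> e0; have P3 := base_ge3.
have z1 : `| `|P|^-1 | < 1 by rewrite normfV normr_id invf_lt1; lra.
have /cvgrPdist_lt/(_ _ e0) := @cvg_geometric R B _ z1.
move=> [N _ /(_ N (leqnn N))] /=.
rewrite /geometric /= sub0r normrN exprVn => h.
by exists N; apply: le_lt_trans h; exact: ler_norm.
Qed.

End DigitGraph.

(** * The digit graph near its ends *)

Section GraphCorner.
Variables (R : realType) (p : int) (m : nat).
Hypotheses (hm : (1 <= m)%N) (hp : `|p| = (2 * m + 1)%N%:Z).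
Local Notation V := 'cV[R]_2.
Local Notation X := (@abscissa R).
Local Notation Y := (@ordinate R).
Local Notation P := (p%:~R : R).
Local Notation beta := (@odd_part R).
Local Notation G := (@digit_graph R p m).

Lemma le_geometric (a b B : R) : (forall n, a <= b + B / `|P| ^+ n) -> a <= b.
Proof.
move=> h; rewrite leNgt; apply/negP => ba.
have [n hn] := geometric_small hm hp B (e := a - b) ltac:(by rewrite subr_gt0).
by have := h n; lra.
Qed.

(** Rounding [P * y] to a digit and iterating gives points of the graph whose
    ordinates are as close to [y] as desired; the set of ordinates is compact. *)
Lemma graph_fiber y : `|y| <= 1 / 2 -> exists2 g, G g & Y g = y.
Proof.
have P3 := base_ge3 R hm hp.
have Pn := base_norm R hp.
have P0 := base_neq0 R hm hp.
have approx n z : `|z| <= 1 / 2 -> exists2 g, G g & `|z - Y g| <= 1 / `|P| ^+ n.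
  elim: n z => [|n IH] z hz.
    exists 0; first exact: digit_graph0.
    by rewrite /Y mxE subr0 expr0; lra.
  have [|j hj hz'] := digit_near (t := P * z) (m := m).
    by rewrite normrM; apply: le_trans (ler_wpM2l _ hz) _ => //; rewrite Pn; lra.
  have [g Gg hg] := IH _ hz'.
  exists (branch p j g); first exact: digit_graph_branch.
  rewrite /branch coordE exprS (_ : z - _ = (P * z - j%:~R - Y g) / P); last by field.
  rewrite normrM normfV invfM mulrCA mulrC ler_wpM2l ?invr_ge0 // mulrC; lra.
move=> hy.
have cl : closed (Y @` G).
  apply: compact_closed; first exact: Rhausdorff.
  apply: continuous_compact; last exact: compact_digit_graph.
  by apply: continuous_subspaceT; exact: continuous_ordinate.
suff : (Y @` G) y by case=> g Gg <-; exists g.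
rewrite (iffLR (closure_id _) cl) => B /nbhs_ballP[e /= e0 hB].
have [n hn] := geometric_small hm hp 1 e0.
have [g Gg hg] := approx n y hy.
exists (Y g); split; first by exists g.
by apply: hB; rewrite /ball /=; lra.
Qed.

(** The fixed point of [z |-> (z + beta m)/p].  The values of the graph at both
    ends of [[-1/2, 1/2]] are equal to it, because [m] and [- m] have the same
    parity. *)
Definition corner_height : R := beta m / (P - 1).
Local Notation zc := corner_height.

Lemma base_sub1 : P - 1 != 0.
Proof.
have P3 := base_ge3 R hm hp.
rewrite subr_eq0; apply/eqP => e; move: P3; rewrite e normr1; lra.
Qed.

Lemma corner_fixed : P * zc = zc + beta m.
Proof. by rewrite /corner_height; field; exact: base_sub1. Qed.

Lemma corner_le1 : `|zc| <= 1.
Proof.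
have P3 := base_ge3 R hm hp.
have := congr1 Num.norm corner_fixed; rewrite normrM => e.
have := ler_normD zc (beta m); rewrite -e.
have /andP[b0 b1] := odd_part01 R m; rewrite (ger0_norm b0) => h.
have := normr_ge0 zc; have := ler_wpM2r (normr_ge0 zc) P3; lra.
Qed.

(** If the ordinate is within [1/(2|p|)] of an end of [[-1/2, 1/2]], then the
    first digit is [m] or [- m], and expanding once multiplies both sides by
    [|p|]; otherwise the right-hand side is at least 2,
    which bounds the left-hand side. *)
Lemma graph_corner g : G g -> `|X g - zc| <= 4 * `|P| * (1 / 2 - `|Y g|).
Proof.
have P3 := base_ge3 R hm hp.
have Pn := base_norm R hp.
move=> Gg; apply: (le_geometric (B := 2)) => n; elim: n g Gg => [|n IH] g Gg.
  have [Xg Yg] := digit_graph_box Gg; rewrite expr0 divr1.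
  have := ler_normB (X g) zc; have := corner_le1.
  have : 0 <= 4 * `|P| * (1 / 2 - `|Y g|) by rewrite mulr_ge0 ?mulr_ge0 // subr_ge0.
  lra.
have Pgt0 : 0 < `|P| by lra.
have tail0 : 0 <= 2 / `|P| ^+ n.+1 by rewrite divr_ge0 // exprn_ge0.
have [far|near] := leP (1 / 2) (`|P| * (1 / 2 - `|Y g|)).
  have [Xg Yg] := digit_graph_box Gg.
  have := ler_normB (X g) zc; have := corner_le1.
  move: (2 / _) tail0 => t t0; move: `|P| far => q far; lra.
have [j hj [g' Gg' [eX eY]]] := digit_graph_step hm hp Gg.
have [_ Yg'] := digit_graph_box Gg'.
have PY : m%:R < `|Y g' + j%:~R| by rewrite -eY normrM; lra.
have hjR := digit_le R hj.
have mR : m%:R = m%:Z%:~R :> R by rewrite -pmulrn.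
have m1 : 1 <= m%:R :> R by rewrite ler1n.
have [ej eYg] : beta j = beta m /\ `|Y g' + j%:~R| = m%:R + `|Y g'|.
  have jm : (m%:Z <= `|j|)%R.
    rewrite -ltzD1 -(ltr_int R) intrD intr_norm -mR.
    by have := ler_normD (Y g') j%:~R; lra.
  move: Yg'; rewrite ler_norml => hY.
  have [E|E] := extreme_digit hj jm.
    split; first by rewrite E.
    move: PY; rewrite E -mR gtr0_norm; last lra.
    by move=> ?; rewrite gtr0_norm; lra.
  split; first by rewrite E odd_partN.
  move: PY; rewrite E intrN -mR ltr0_norm; last lra.
  by move=> ?; rewrite ltr0_norm; lra.
have PYg : `|P| * `|Y g| = m%:R + `|Y g'| by rewrite -normrM eY.
have PXg : `|P| * `|X g - zc| = `|X g' - zc|.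
  by rewrite -normrM mulrBr eX corner_fixed ej; congr `| _ |; ring.
have := IH g' Gg'; rewrite -PXg.
rewrite (_ : 1 / 2 - `|Y g'| = `|P| * (1 / 2 - `|Y g|)); last by lra.
rewrite (_ : 2 / `|P| ^+ n = `|P| * (2 / `|P| ^+ n.+1)); last first.
  by rewrite exprS; field; rewrite expf_neq0 ?gt_eqF.
rewrite mulrCA -mulrDr ler_pM2l //.
Qed.

Lemma graph_at_edge g : G g -> `|Y g| = 1 / 2 -> X g = zc.
Proof.
move=> Gg Yg; have := graph_corner Gg; rewrite Yg subrr mulr0 normr_le0 subr_eq0.
by move/eqP.
Qed.

(** Two expansions of one ordinate that differ in the first digit are expansions
    at the two ends of adjacent intervals. *)
Lemma graph_neighbours j j' g g' : G g -> G g' -> j != j' ->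
  Y g + j%:~R = Y g' + j'%:~R ->
  [/\ X g = zc, X g' = zc &
      (j' = j + 1 /\ Y g = 1 / 2) \/ (j = j' + 1 /\ Y g' = 1 / 2)].
Proof.
move=> Gg Gg' jj' e; have [_ Yg] := digit_graph_box Gg; have [_ Yg'] := digit_graph_box Gg'.
have [Yg1 Yg1'] := (Yg, Yg'); move: Yg1 Yg1'; rewrite !ler_norml => h h'.
have [h1|h1] : j' = j + 1 \/ j = j' + 1.
  have : `|(j - j')%:~R : R| <= 1 by rewrite intrD intrN ler_norml; lra.
  rewrite -intr_norm -(_ : 1%:~R = 1) // ler_int; move: jj' => /eqP; lia.
- move: e; rewrite h1 intrD => e.
  by split; [apply: graph_at_edge => //| apply: graph_at_edge => //|left; split=> //; lra];
   [rewrite ger0_norm; lra|rewrite ler0_norm; lra].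
- move: e; rewrite h1 intrD => e.
  by split; [apply: graph_at_edge => //| apply: graph_at_edge => //|right; split=> //; lra];
   [rewrite ler0_norm; lra|rewrite ger0_norm; lra].
Qed.

(** Expand both points while their digits agree, which contracts their distance
    by [1/|p|] each time; when the digits first differ, the values differ by the
    difference of parities over [p]. *)
Lemma graph_fiber_diam g g' : G g -> G g' -> Y g = Y g' -> `|X g - X g'| <= 1 / `|P|.
Proof.
have P3 := base_ge3 R hm hp.
move=> Gg Gg' e; apply: (le_geometric (B := 2)) => n; elim: n g g' Gg Gg' e => [|n IH] g g' Gg Gg' e.
  have [Xg _] := digit_graph_box Gg; have [Xg' _] := digit_graph_box Gg'.
  have := ler_normB (X g) (X g').
  have : 0 <= 1 / `|P| by rewrite divr_ge0.
  by rewrite expr0; lra.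
have Pgt0 : 0 < `|P| by lra.
have [j hj [h Gh [eX eY]]] := digit_graph_step hm hp Gg.
have [j' hj' [h' Gh' [eX' eY']]] := digit_graph_step hm hp Gg'.
have tail0 : 0 <= 2 / `|P| ^+ n.+1 by rewrite divr_ge0 // exprn_ge0.
rewrite -(ler_pM2l Pgt0) -normrM mulrBr eX eX' mulrDr mulrCA divff ?gt_eqF // mulr1.
have Ejj : Y h + j%:~R = Y h' + j'%:~R by rewrite -eY -eY' e.
have [jj|jj] := eqVneq j j'.
  rewrite -jj in Ejj *; have := IH h h' Gh Gh' (addIr _ Ejj).
  rewrite (_ : 2 / `|P| ^+ n = `|P| * (2 / `|P| ^+ n.+1)); last first.
    by rewrite exprS; field; rewrite expf_neq0 ?gt_eqF.
  rewrite (_ : X h + _ - _ = X h - X h'); last by ring.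
  have : 1 / `|P| <= 1 by rewrite ler_pdivrMr //; lra.
  lra.
have [-> -> hjj] := graph_neighbours Gh Gh' jj Ejj.
have : `|beta j - beta j'| = 1.
  by case: hjj => -[-> _]; rewrite ?(distrC (beta j)) odd_part_succ.
rewrite (_ : zc + beta j - _ = beta j - beta j'); last by ring.
have : 0 <= `|P| * (2 / `|P| ^+ n.+1) by rewrite mulr_ge0.
lra.
Qed.

End GraphCorner.

(** * The jumps of the digit graph *)

Lemma int_dist_ge1 (R : realType) (i j : int) : i != j -> 1 <= `|(i - j)%:~R : R|.
Proof.
move=> ij; rewrite -intr_norm -[leLHS]/(1%:~R) ler_int.
by rewrite -gtz0_ge1 normr_gt0 subr_eq0.
Qed.

Lemma int_not_adjacent (i j : int) : i != j -> i != j + 1 -> i <= j - 1 \/ j + 2 <= i.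
Proof. lia. Qed.

Section GraphJumps.
Variables (R : realType) (p : int) (m : nat).
Hypotheses (hm : (1 <= m)%N) (hp : `|p| = (2 * m + 1)%N%:Z).
Local Notation V := 'cV[R]_2.
Local Notation X := (@abscissa R).
Local Notation Y := (@ordinate R).
Local Notation P := (p%:~R : R).
Local Notation beta := (@odd_part R).
Local Notation G := (@digit_graph R p m).
Local Notation zc := (@corner_height R p m).

(** A jump without the bound on its size; the rationality of its height is
    recorded here because it is inherited along the branches. *)
Definition one_sided_limits (y0 z0 z1 : R) : Prop :=
  [/\ `|y0| < 1 / 2, exists q : rat, y0 = ratr q & exists C : R, forall h, G h ->
    [/\ Y h < y0 -> `|X h - z0| <= C * `|Y h - y0|,
        y0 < Y h -> `|X h - z1| <= C * `|Y h - y0| &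
        Y h = y0 -> X h = z0 \/ X h = z1]].

(** Multiplication by a negative base reverses the vertical order and so
    exchanges the two limits; this is the only place where the sign of the base
    matters. *)
Lemma one_sided_limits_base (y0 za zb C : R) :
  `|y0| < 1 / 2 -> (exists q : rat, y0 = ratr q) ->
  (forall h, G h ->
    [/\ P * Y h < P * y0 -> `|X h - za| <= C * `|Y h - y0|,
        P * y0 < P * Y h -> `|X h - zb| <= C * `|Y h - y0| &
        Y h = y0 -> X h = za \/ X h = zb]) ->
  exists z0 z1, one_sided_limits y0 z0 z1.
Proof.
move=> hy hq hC; have P0 := base_neq0 R hm hp.
have [Pp|Pn|P00] := ltrgt0P P; last by rewrite P00 eqxx in P0.
  exists za, zb; split=> //; exists C => h Gh; have [h1 h2 h3] := hC h Gh.
  by rewrite !(ltr_pM2l Pp) in h1 h2.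
exists zb, za; split=> //; exists C => h Gh; have [h1 h2 h3] := hC h Gh.
by rewrite !(ltr_nM2l Pn) in h1 h2; split=> // e; case: (h3 e); [right|left].
Qed.

Lemma branch_ordinate_lt y j : `|y| < 1 / 2 -> digit_range m j ->
  `|(y + j%:~R) / P| < 1 / 2.
Proof.
move=> hy /(digit_le R) hj; have P3 := base_ge3 R hm hp; have Pn := base_norm R hp.
have Pgt0 : 0 < `|P| by lra.
rewrite normrM normfV ltr_pdivrMr //; apply: le_lt_trans (ler_normD _ _) _.
by rewrite Pn; lra.
Qed.

(** Away from the height [a] a linear bound holds trivially, since the graph is
    bounded. *)
Lemma far_bound (C z d a : R) h : 0 < d -> G h -> d <= `|Y h - a| ->
  `|X h - z| <= (`|C| + (1 + `|z|) / d) * `|Y h - a|.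
Proof.
move=> d0 Gh hd; have [Xh _] := digit_graph_box Gh.
rewrite mulrDl; have c0 : 0 <= `|C| * `|Y h - a| by rewrite mulr_ge0.
suff : `|X h - z| <= (1 + `|z|) / d * `|Y h - a| by lra.
have z0 : 0 <= (1 + `|z|) / d by rewrite divr_ge0 ?addr_ge0 // ltW.
apply: le_trans (ler_wpM2l z0 hd); rewrite divfK ?gt_eqF //.
by have := ler_normB (X h) z; lra.
Qed.

(** A jump of the graph reappears in each branch; the other branches stay at
    distance [d] from its height. *)
Lemma one_sided_limits_branch (y z0 z1 : R) j : digit_range m j ->
  one_sided_limits y z0 z1 ->
  exists z0' z1', one_sided_limits ((y + j%:~R) / P) z0' z1'.
Proof.
move=> hj [hy [q hq] [C hC]].
have P3 := base_ge3 R hm hp; have Pn := base_norm R hp; have P0 := base_neq0 R hm hp.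
have Pgt0 : 0 < `|P| by lra.
pose y0 := (y + j%:~R) / P; pose d := (1 / 2 - `|y|) / `|P|.
have d0 : 0 < d by rewrite divr_gt0 // subr_gt0.
have Py0 : P * y0 = y + j%:~R by rewrite /y0 mulrC divfK.
pose za := (z0 + beta j) / P; pose zb := (z1 + beta j) / P.
pose C1 := `|C| + (1 + `|za|) / d; pose C2 := `|C| + (1 + `|zb|) / d.
apply: (@one_sided_limits_base y0 za zb (Num.max C1 C2)).
- exact: branch_ordinate_lt.
- by exists ((q + j%:~R) / p%:~R); rewrite fmorph_div rmorphD /= !ratr_int -hq.
move=> h Gh; have [j' hj' [g Gg [eX eY]]] := digit_graph_step hm hp Gh.
have [Cle1 Cle2] : C1 <= Num.max C1 C2 /\ C2 <= Num.max C1 C2.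
  by rewrite !le_max !lexx orbT.
have CC : `|C| <= C1 /\ `|C| <= C2.
  by split; rewrite lerDl divr_ge0 ?addr_ge0 // ltW.
have up c : c <= Num.max C1 C2 -> forall x, x <= c * `|Y h - y0| -> x <= Num.max C1 C2 * `|Y h - y0|.
  by move=> hc x hx; apply: le_trans hx _; rewrite ler_wpM2r.
have [E|N] := eqVneq j' j; last first.
  have far : d <= `|Y h - y0|.
    rewrite /d ler_pdivrMr // [leRHS]mulrC -normrM mulrBr eY Py0.
    rewrite (_ : Y g + _ - _ = (j' - j)%:~R - (y - Y g)); last by rewrite intrD intrN; ring.
    have [_ Yg] := digit_graph_box Gg.
    have : 1 <= `|(j' - j)%:~R : R|.
      exact: int_dist_ge1.
    have := ler_normB y (Y g); have := lerB_dist (j' - j)%:~R (y - Y g); lra.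
  split=> [_|_|e].
  - by apply: up Cle1 _ _; exact: far_bound.
  - by apply: up Cle2 _ _; exact: far_bound.
  - by move: far; rewrite e subrr normr0; lra.
have dY : `|P| * `|Y h - y0| = `|Y g - y|.
  by rewrite -normrM mulrBr eY Py0 E; congr `| _ |; ring.
have dX z : `|P| * `|X h - (z + beta j) / P| = `|X g - z|.
  by rewrite -normrM mulrBr eX E [P * (_ / P)]mulrC divfK //; congr `| _ |; ring.
have [h1 h2 h3] := hC g Gg.
have key z : `|X g - z| <= C * `|Y g - y| -> `|X h - (z + beta j) / P| <= `|C| * `|Y h - y0|.
  rewrite -dX -dY mulrCA ler_pM2l // => hz; apply: le_trans hz _.
  by rewrite ler_wpM2r // ler_norm.
rewrite eY Py0 E !ltrD2r; split.
- by move=> /h1 /key; apply: up; lra.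
- by move=> /h2 /key; apply: up; lra.
- move=> e; have : Y g = y by apply: (addIr j%:~R); rewrite -Py0 -e eY E.
  have XE : X h = (X g + beta j) / P by rewrite -E -eX mulrC mulKf.
  by move=> /h3[] Xg; [left|right]; rewrite XE Xg.
Qed.

(** The branches [j] and [j + 1] meet at this height with the values [za] and
    [zb]; both are approached linearly by graph_corner. *)
Lemma one_sided_limits_boundary j : digit_range m j -> digit_range m (j + 1) ->
  exists z0 z1, one_sided_limits ((1 / 2 + j%:~R) / P) z0 z1.
Proof.
move=> hj hj1.
have P3 := base_ge3 R hm hp; have Pn := base_norm R hp; have P0 := base_neq0 R hm hp.
have Pgt0 : 0 < `|P| by lra.
pose y0 := (1 / 2 + j%:~R) / P; pose d := 1 / `|P|.
have d0 : 0 < d by rewrite divr_gt0.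
have Py0 : P * y0 = 1 / 2 + j%:~R by rewrite /y0 mulrC divfK.
pose za := (zc + beta j) / P; pose zb := (zc + beta (j + 1)) / P.
pose C1 := `|4 * `|P| | + (1 + `|za|) / d; pose C2 := `|4 * `|P| | + (1 + `|zb|) / d.
apply: (@one_sided_limits_base y0 za zb (Num.max C1 C2)).
- have := digit_le R hj; have := digit_le R hj1.
  rewrite intrD !ler_norml => h1 h2.
  rewrite normrM normfV ltr_pdivrMr // Pn ltr_norml; lra.
- by exists ((2^-1 + j%:~R) / p%:~R); rewrite fmorph_div rmorphD /= fmorphV !ratr_int /y0 mul1r rmorph_nat.
move=> h Gh; have [j' hj' [g Gg [eX eY]]] := digit_graph_step hm hp Gh.
have [Cle1 Cle2] : C1 <= Num.max C1 C2 /\ C2 <= Num.max C1 C2.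
  by rewrite !le_max !lexx orbT.
have CC : 4 * `|P| <= C1 /\ 4 * `|P| <= C2.
  rewrite /C1 /C2 (ger0_norm (x := 4 * `|P|)); last by lra.
  by split; rewrite lerDl divr_ge0 ?addr_ge0 // ltW.
have up c : c <= Num.max C1 C2 -> forall x, x <= c * `|Y h - y0| -> x <= Num.max C1 C2 * `|Y h - y0|.
  by move=> hc x hx; apply: le_trans hx _; rewrite ler_wpM2r.
have [_ Yg] := digit_graph_box Gg; move: (Yg); rewrite ler_norml => Yg'.
have dY : `|P| * `|Y h - y0| = `|Y g + j'%:~R - (1 / 2 + j%:~R)|.
  by rewrite -normrM mulrBr eY Py0.
have XE : X h = (X g + beta j') / P by rewrite -eX mulrC mulKf.
have dX : `|P| * `|X h - (zc + beta j') / P| = `|X g - zc|.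
  by rewrite -normrM mulrBr eX [P * (_ / P)]mulrC divfK //; congr `| _ |; ring.
have corner := graph_corner hm hp Gg.
have key : 1 / 2 - `|Y g| <= `|P| * `|Y h - y0| ->
    `|X h - (zc + beta j') / P| <= 4 * `|P| * `|Y h - y0|.
  move=> hk; rewrite -(ler_pM2l Pgt0) dX; apply: le_trans corner _.
  by rewrite mulrCA ler_wpM2l // mulr_ge0.
have [E|N1] := eqVneq j' j.
  have k : `|X h - za| <= 4 * `|P| * `|Y h - y0|.
    rewrite /za -E; apply: key; rewrite dY E.
    rewrite (_ : _ + _ - _ = - (1 / 2 - Y g)); last by ring.
    rewrite normrN; apply: le_trans (ler_norm _).
    by have := ler_norm (Y g); lra.
  split.
  - by move=> _; apply: up k; lra.
  - by rewrite eY Py0 E ltrD2r => hlt; exfalso; lra.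
  - by move=> e; left; move: k; rewrite e subrr normr0 mulr0 normr_le0 subr_eq0 => /eqP.
have [E|N2] := eqVneq j' (j + 1).
  have k : `|X h - zb| <= 4 * `|P| * `|Y h - y0|.
    rewrite /zb -E; apply: key; rewrite dY E intrD.
    rewrite (_ : _ + _ - _ = Y g + 1 / 2); last by field.
    apply: le_trans (ler_norm _).
    by have := ler_norm (- Y g); rewrite normrN; lra.
  split.
  - by rewrite eY Py0 E intrD => hlt; exfalso; lra.
  - by move=> _; apply: up k; lra.
  - by move=> e; right; move: k; rewrite e subrr normr0 mulr0 normr_le0 subr_eq0 => /eqP.
have far : d <= `|Y h - y0|.
  rewrite /d ler_pdivrMr // [leRHS]mulrC dY.
  have [h1|h1] := int_not_adjacent N1 N2.
    by move: h1; rewrite -(ler_int R) intrD => h1; rewrite ler_normr; apply/orP; right; lra.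
  by move: h1; rewrite -(ler_int R) intrD => h1; rewrite ler_normr; apply/orP; left; lra.
split=> [_|_|e].
- by apply: up Cle1 _ _; exact: far_bound.
- by apply: up Cle2 _ _; exact: far_bound.
- by move: far; rewrite e subrr normr0; lra.
Qed.

(** Induction on the number of common digits, which is finite as the points are
    distinct. *)
Lemma graph_two_points g g' : G g -> G g' -> Y g = Y g' -> X g != X g' ->
  exists z0 z1, one_sided_limits (Y g) z0 z1.
Proof.
move=> Gg Gg' e ne.
have P3 := base_ge3 R hm hp; have P0 := base_neq0 R hm hp.
have Pgt0 : 0 < `|P| by lra.
have [n hn] := geometric_small hm hp 2 (e := `|X g - X g'|) ltac:(by rewrite normr_gt0 subr_eq0).
elim: n g g' Gg Gg' e ne hn => [|n IH] g g' Gg Gg' e ne hn.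
  have [Xg _] := digit_graph_box Gg; have [Xg' _] := digit_graph_box Gg'.
  by have := ler_normB (X g) (X g'); move: hn; rewrite expr0; lra.
have [j hj [h Gh [eX eY]]] := digit_graph_step hm hp Gg.
have [j' hj' [h' Gh' [eX' eY']]] := digit_graph_step hm hp Gg'.
have YE : Y g = (Y h + j%:~R) / P by rewrite -eY mulrC mulKf.
have Ejj : Y h + j%:~R = Y h' + j'%:~R by rewrite -eY -eY' e.
have [jj|jj] := eqVneq j j'.
  have hX : `|X h - X h'| = `|P| * `|X g - X g'|.
    by rewrite -normrM mulrBr eX eX' jj; congr `| _ |; ring.
  have [|||z0 [z1 hz]] := IH h h' Gh Gh' _ _ _.
  - by apply: (addIr j%:~R); rewrite Ejj jj.
  - by rewrite -subr_eq0 -normr_gt0 hX mulr_gt0 // normr_gt0 subr_eq0.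
  - rewrite hX; move: hn; rewrite -(ltr_pM2l Pgt0); congr (_ < _).
    by rewrite exprS; field; rewrite expf_neq0 ?gt_eqF.
  by rewrite YE; exact: one_sided_limits_branch hz.
have [_ _ [[j'E Yh]|[jE Yh']]] := graph_neighbours hm hp Gh Gh' jj Ejj.
  by rewrite YE Yh; apply: one_sided_limits_boundary => //; rewrite -j'E.
by rewrite YE Ejj Yh'; apply: one_sided_limits_boundary => //; rewrite -jE.
Qed.

Definition scaled_graph (eps : R) : set V := [set vec2 (eps * X g) (Y g) | g in G].

Lemma scaled_graph_jump eps g g' : `|eps| < `|P| ->
  scaled_graph eps g -> scaled_graph eps g' -> Y g = Y g' -> X g <> X g' ->
  (exists z0 z1, jump (scaled_graph eps) (Y g) z0 z1) /\ exists q : rat, Y g = ratr q.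
Proof.
move=> heps [h Gh <-] [h' Gh' <-]; rewrite !coordE => e ne.
have P3 := base_ge3 R hm hp.
have neX : X h != X h' by apply: contra_notN ne => /eqP ->.
have eps0 : 0 < `|eps|.
  by rewrite normr_gt0; apply: contra_notN ne => /eqP ->; rewrite !mul0r.
have [z0 [z1 [hy hq [C hC]]]] := graph_two_points Gh Gh' e neX.
split=> //; exists (eps * z0), (eps * z1).
have dz : `|z1 - z0| = `|X h - X h'|.
  have [_ _ /(_ erefl) h1] := hC h Gh; have [_ _ /(_ (esym e)) h2] := hC h' Gh'.
  by move: neX; case: h1 => ->; case: h2 => ->; rewrite ?eqxx // distrC.
split=> //.
  rewrite -mulrBr normrM dz mulr_gt0 //= ?normr_gt0 ?subr_eq0 //.
  have := graph_fiber_diam hm hp Gh Gh' e; rewrite ler_pdivlMr; last by lra.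
  have := normr_ge0 (X h - X h'); have : 0 < `|X h - X h'| by rewrite normr_gt0 subr_eq0.
  nra.
exists (`|eps| * C) => _ [k Gk <-]; rewrite !coordE -!mulrBr !normrM.
have [h1 h2 h3] := hC k Gk; split.
- move=> hk; have := h1 hk; rewrite (distrC (Y k)) (gtr0_norm (x := Y h - Y k)) ?subr_gt0 // => hk'.
  by rewrite -mulrA ler_wpM2l.
- move=> hk; have := h2 hk; rewrite (gtr0_norm (x := Y k - Y h)) ?subr_gt0 // => hk'.
  by rewrite -mulrA ler_wpM2l.
- by move=> /h3[] ->; [left|right].
Qed.

End GraphJumps.

(** * Closed projections and connected components *)

Section Topology.
Variable T : topologicalType.

(** The tube lemma, applied to the complement of [C]. *)
Lemma closed_projection (U : topologicalType) (K : set U) (C : set (U * T)) :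
  compact K -> closed C -> closed [set t | exists2 u, K u & C (u, t)].
Proof.
move=> cK clC; rewrite -openC openE => t /= nt.
have oC : open (~` C) by rewrite openC.
have : \forall t' \near t, K `<=` [set u | ~ C (u, t')].
  move/compact_near_coveringP: cK; apply => u Ku.
  have : nbhs (u, t) (~` C) by apply: open_nbhs_nbhs; split=> // Cut; apply: nt; exists u.
  by apply: filterS => -[a b].
by apply: filterS => t' h [u Ku]; exact: h.
Qed.

(** A clopen part of [S] meets the dense set [U], hence contains it, hence is
    all of [S]. *)
Lemma connected_between (U S : set T) : connected U -> U `<=` S -> S `<=` closure U ->
  connected S.
Proof.
move=> cU US SU B [b Bb] [C oC BC] [D clD BD].
have UB : U `<=` D.
  have <- : U `&` C = U.
    apply: cU.
    - have Cb : nbhs b C by apply: open_nbhs_nbhs; split=> //; move: Bb; rewrite BC => -[].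
      by have [|u ?] := SU b _ C Cb; [move: Bb; rewrite BC => -[]|exists u].
    - by exists C.
    - exists D => //; apply/seteqP; split=> u [Uu].
        by move=> Cu; split=> //; have : B u by [rewrite BC; split=> //; exact: US]; rewrite BD => -[].
      by move=> Du; split=> //; have : B u by [rewrite BD; split=> //; exact: US]; rewrite BC => -[].
  by move=> u [Uu Cu]; have : B u by [rewrite BC; split=> //; exact: US]; rewrite BD => -[].
rewrite BD; apply/seteqP; split=> u; first by case.
move=> Su; split=> //; rewrite (iffLR (closure_id D) clD).
by apply: closureS UB _ _; exact: SU.
Qed.

Lemma components_connected (A : set T) : A !=set0 -> connected A ->
  components A = [set A].
Proof.
move=> [a Aa] cA; apply/seteqP; split=> [_ [x Ax <-]|_ ->].
  by rewrite /= connected_component_id.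
by exists a; rewrite ?connected_component_id.
Qed.

(** A piece of a disjoint union of open sets is also relatively closed in it. *)
Lemma component_of_piece (I : eqType) (J : set I) (F : I -> set T) (j : I) (x : T) :
  J j -> (forall i, J i -> open (F i)) ->
  (forall i k y, J i -> J k -> F i y -> F k y -> i = k) ->
  F j x ->
  connected_component (\bigcup_(i in J) F i) x = connected_component (F j) x.
Proof.
move=> Jj oF dF Fx; have FU : F j `<=` \bigcup_(i in J) F i by move=> y Fy; exists j.
apply/seteqP; split; last first.
  apply: connected_component_max.
  - exact: connected_component_refl.
  - by move=> y /connected_component_sub /FU.
  - exact: component_connected.
set C := connected_component _ _.
have Cx : C x by apply: connected_component_refl; exact: FU.
have cC : connected C by exact: component_connected.
have CF : C `&` F j = C.
  apply: cC; first by exists x.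
    by exists (F j); [exact: oF|].
  exists (~` (\bigcup_(i in J `\ j) F i)).
    rewrite closedC; apply: bigcup_open => i [Ji _]; exact: oF.
  apply/seteqP; split=> y [Cy].
    move=> Fy; split=> // -[i [Ji ij] Fiy]; apply: ij; exact: dF Fy.
  move=> ny; split=> //; have [i Ji Fiy] := connected_component_sub Cy.
  by have [<-//|ij] := eqVneq i j; case: ny; exists i => //; split=> //; exact/eqP.
apply: connected_component_max => //.
by rewrite -CF; exact: subIsetr.
Qed.

End Topology.

(** * Tiles with small shift *)

Section TileRegion.
Variables (R : realType) (p : int) (m : nat).
Hypotheses (hm : (1 <= m)%N) (hp : `|p| = (2 * m + 1)%N%:Z).
Local Notation V := 'cV[R]_2.
Local Notation X := (@abscissa R).
Local Notation Y := (@ordinate R).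
Local Notation P := (p%:~R : R).
Local Notation beta := (@odd_part R).
Local Notation G := (@digit_graph R p m).

Definition tile (eps : R) : set V :=
  [set v | exists2 g, G g & Y g = Y v /\ `|X v - eps * X g| <= 1 / 2].

Lemma compact_tile eps : compact (tile eps).
Proof.
have -> : tile eps = (fun q : R * V => vec2 (q.1 + eps * X q.2) (Y q.2)) @`
    (`[(- (1 / 2)), (1 / 2)]%classic `*` G).
  apply/seteqP; split=> [v [g Gg [Yg Xv]]|_ [[s g] [/= + Gg] <-]].
    exists (X v - eps * X g, g); last by rewrite /= subrK Yg vec2_surj.
    by split=> //=; rewrite in_itv /= -ler_norml.
  rewrite in_itv /= => hs; exists g => //; rewrite !coordE addrK; split=> //.
  by rewrite ler_norml.
apply: continuous_compact; last first.
  by apply: compact_setX; [exact: segment_compact|exact: compact_digit_graph].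
have c1 : continuous (fun q : R * V => q.1) by move=> q; exact: cvg_fst.
have c2 : continuous (fun q : R * V => q.2) by move=> q; exact: cvg_snd.
have cX := continuous_after c2 (@continuous_abscissa R).
have cY := continuous_after c2 (@continuous_ordinate R).
apply: continuous_subspaceT; apply: continuous_vec2 => //.
apply: continuous_add => //; apply: continuous_mul => //; exact: continuous_const.
Qed.

Lemma compact_scaled_graph (eps : R) : compact (scaled_graph p m eps).
Proof.
apply: continuous_compact; last exact: compact_digit_graph.
have cX := @continuous_abscissa R; have cY := @continuous_ordinate R.
apply: continuous_subspaceT; apply: continuous_vec2 => //.
by apply: continuous_mul => //; exact: continuous_const.
Qed.

Lemma plane_hausdorff : hausdorff_space V.
Proof. exact: norm_hausdorff. Qed.

Lemma closed_tile eps : closed (tile eps).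
Proof. apply: compact_closed plane_hausdorff _; exact: compact_tile. Qed.

Definition right_side (eps s : R) : set V :=
  [set v | exists2 g, scaled_graph p m eps g & Y g = Y v /\ X g <= X v - s].
Definition left_side (eps s : R) : set V :=
  [set v | exists2 g, scaled_graph p m eps g & Y g = Y v /\ X v - s <= X g].

Lemma closed_sides eps s : closed (right_side eps s) /\ closed (left_side eps s).
Proof.
have c1 : continuous (fun q : V * V => q.1) by move=> q; exact: cvg_fst.
have c2 : continuous (fun q : V * V => q.2) by move=> q; exact: cvg_snd.
have cX1 := continuous_after c1 (@continuous_abscissa R).
have cY1 := continuous_after c1 (@continuous_ordinate R).
have cX2 := continuous_after c2 (@continuous_abscissa R).
have cY2 := continuous_after c2 (@continuous_ordinate R).
have cXs : continuous (fun q : V * V => X q.2 - s).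
  by apply: continuous_sub => //; exact: continuous_const.
have clY : closed [set q : V * V | Y q.1 = Y q.2].
  rewrite (_ : [set q | _] = [set q | Y q.1 <= Y q.2] `&` [set q | Y q.2 <= Y q.1]).
    by apply: closedI; exact: closed_le_continuous.
  apply/seteqP; split=> q /=; first by move=> ->; rewrite lexx.
  by case=> h1 h2; apply: le_anti; rewrite h1 h2.
split.
- apply: (@closed_projection _ _ _ ([set q : V * V | Y q.1 = Y q.2] `&` [set q | X q.1 <= X q.2 - s])).
    exact: compact_scaled_graph.
  by apply: closedI => //; exact: closed_le_continuous.
- apply: (@closed_projection _ _ _ ([set q : V * V | Y q.1 = Y q.2] `&` [set q | X q.2 - s <= X q.1])).
    exact: compact_scaled_graph.
  by apply: closedI => //; exact: closed_le_continuous.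
Qed.

Lemma tile_strip eps : tile eps `<=` @strip R.
Proof.
move=> v [g Gg [Yg _]]; have [_ ?] := digit_graph_box Gg.
by rewrite /strip /= -Yg -ler_norml.
Qed.

Lemma scaled_fiber_diam (eps : R) g g' : `|eps| < `|P| -> scaled_graph p m eps g ->
  scaled_graph p m eps g' -> Y g = Y g' -> `|X g - X g'| < 1.
Proof.
move=> heps [h Gh <-] [h' Gh' <-]; rewrite !coordE => e.
have P3 := base_ge3 R hm hp.
have := graph_fiber_diam hm hp Gh Gh' e; rewrite ler_pdivlMr; last by lra.
rewrite -mulrBr normrM; have := normr_ge0 (X h - X h'); have := normr_ge0 eps.
have [->|n0] := eqVneq `|X h - X h'| 0; first by rewrite mulr0.
have : 0 < `|X h - X h'| by rewrite lt_neqAle eq_sym n0 normr_ge0.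
nra.
Qed.

(** Two points of one fibre are at distance less than 1, so their translates by
    the interval [[-1/2, 1/2]] overlap and the slice of the tile is an interval. *)
Lemma tile_sides eps : `|eps| < `|P| -> tile eps =
  [set v | [/\ strip v, right_side eps (- (1 / 2)) v & left_side eps (1 / 2) v]].
Proof.
move=> heps; apply/seteqP; split=> v.
  move=> /[dup] /tile_strip sv [g Gg [Yg]]; rewrite ler_norml => Xv.
  have Sg : scaled_graph p m eps (vec2 (eps * X g) (Y g)) by exists g.
  by split=> //; exists (vec2 (eps * X g) (Y g)); rewrite // !coordE; split=> //; lra.
case=> sv [k1 /[dup] Gk1 [g1 Gg1 E1] [Y1 X1]] [k2 /[dup] Gk2 [g2 Gg2 E2] [Y2 X2]].
have := scaled_fiber_diam heps Gk1 Gk2 (etrans Y1 (esym Y2)).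
move: X1 Y1 X2 Y2; rewrite -E1 -E2 !coordE => X1 Y1 X2 Y2; rewrite ltr_distl => /andP[d1 d2].
have [h|h] := leP (X v - 1 / 2) (eps * X g1).
  by exists g1 => //; split=> //; rewrite ler_norml; lra.
by exists g2 => //; split=> //; rewrite ler_norml; lra.
Qed.

Lemma tile_region eps : `|eps| < `|P| ->
  disk_like (tile eps) /\
  exists U : set V, [/\ open U, connected U, U !=set0, U `<=` tile eps & tile eps `<=` closure U].
Proof.
move=> heps; rewrite (tile_sides heps).
have [|W [w0 [w1 [hW injW]]]] := @curve_height R (scaled_graph p m eps).
  by move=> g g' Gg Gg' e ne; exact: scaled_graph_jump Gg Gg' e ne.
have bound g : scaled_graph p m eps g -> `|X g| <= `|eps|.
  move=> [h Gh <-]; rewrite coordE normrM; have [Xh _] := digit_graph_box Gh.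
  by apply: ler_piMr.
have sides s : `|s| = 1 / 2 -> curve_sides W (right_side eps s) (left_side eps s) (`|eps| + 1).
  move=> hs; have [s1 s2] : s <= 1 / 2 /\ - s <= 1 / 2.
    by rewrite -hs -{2}normrN !ler_norm.
  split.
  - exact: closed_sides.
  - move=> v /andP[v1 v2]; have [|g Gg Yg] := @graph_fiber R p m hm hp (Y v).
      by rewrite ler_norml v1 v2.
    have [h|h] := leP (eps * X g) (X v - s); [left|right];
      by exists (vec2 (eps * X g) (Y g)); rewrite ?coordE ?(ltW h) //; exists g.
  - move=> v _ Xv [g /bound]; rewrite ler_norml => /andP[? ?] [_ ?].
    have := normr_ge0 eps; lra.
  - move=> v _ Xv [g /bound]; rewrite ler_norml => /andP[? ?] [_ ?].
    have := normr_ge0 eps; lra.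
  - move=> v w _ _ [g1 G1 [Y1 X1]] [g2 G2 [Y2 X2]] [g3 G3 [Y3 X3]] [g4 G4 [Y4 X4]].
    apply: injW hs _ _.
    + by exists g1, g2; rewrite X1 X2.
    + by exists g3, g4; rewrite X3 X4.
apply: (region_between hW (sides _ _) (sides _ _)).
- by rewrite normrN ger0_norm; lra.
- by rewrite ger0_norm; lra.
- move=> v _ _ [g1 G1 [Y1 X1]] [g2 G2 [Y2 X2]].
  have := scaled_fiber_diam heps G1 G2 (etrans Y1 (esym Y2)).
  by rewrite ltr_distl => /andP[? ?]; lra.
Qed.

(** The interior lies between the connected open set given by tile_region and its
    closure. *)
Lemma tile_interior_small eps : `|eps| < `|P| ->
  [/\ connected (tile eps)°, (tile eps)° !=set0 & closure (tile eps)° = tile eps].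
Proof.
move=> /tile_region[_ [U [oU cU [u Uu] UT TU]]].
have UI : U `<=` (tile eps)° by rewrite -open_subsetE.
have clI : closure (tile eps)° = tile eps.
  apply/seteqP; split.
    rewrite [X in _ `<=` X](iffLR (closure_id _) (@closed_tile eps)).
    by apply: closureS; exact: interior_subset.
  by apply: subset_trans TU _; exact: closureS.
split=> //; last by exists u; exact: UI.
apply: connected_between cU UI _.
by apply: subset_trans TU; exact: interior_subset.
Qed.

End TileRegion.

(** * Decomposition of a tile into rows *)

Section TileDecomposition.
Variables (R : realType) (p : int) (m : nat).
Hypotheses (hm : (1 <= m)%N) (hp : `|p| = (2 * m + 1)%N%:Z).
Local Notation V := 'cV[R]_2.
Local Notation X := (@abscissa R).
Local Notation Y := (@ordinate R).
Local Notation P := (p%:~R : R).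
Local Notation beta := (@odd_part R).
Local Notation G := (@digit_graph R p m).
Local Notation tile := (@tile R p m).
Local Notation zc := (@corner_height R p m).

(** The map that places a tile for the parameter [eps / P] as the row of digit
    [j] in the tile for [eps].  Its linear part is the identity horizontally, as
    the horizontal digits fill the width. *)
Definition place (eps : R) (j : int) (v : V) : V :=
  vec2 (X v + eps * beta j / P) ((Y v + j%:~R) / P).
Definition unplace (eps : R) (j : int) (v : V) : V :=
  vec2 (X v - eps * beta j / P) (P * Y v - j%:~R).

Lemma placeK eps j : cancel (place eps j) (unplace eps j).
Proof.
have P0 := base_neq0 R hm hp.
by move=> v; apply: vec2_eq; rewrite /unplace /place !coordE; field.
Qed.

Lemma unplaceK eps j : cancel (unplace eps j) (place eps j).
Proof.
have P0 := base_neq0 R hm hp.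
by move=> v; apply: vec2_eq; rewrite /unplace /place !coordE; field.
Qed.

Lemma continuous_place eps j : continuous (place eps j).
Proof.
rewrite (_ : place eps j = fun v => vec2 (1 * X v + eps * beta j / P) (P^-1 * Y v + j%:~R / P)).
  exact: continuous_affine_map.
by apply/funext => v; rewrite /place mul1r !mulrDl (mulrC P^-1).
Qed.

Lemma continuous_unplace eps j : continuous (unplace eps j).
Proof.
rewrite (_ : unplace eps j = fun v => vec2 (1 * X v + - (eps * beta j / P)) (P * Y v + - j%:~R)).
  exact: continuous_affine_map.
by apply/funext => v; rewrite /unplace mul1r.
Qed.

Lemma mem_place eps j (A : set V) v : (place eps j @` A) v <-> A (unplace eps j v).
Proof.
by rewrite (image_cancel (placeK eps j) (unplaceK eps j)).
Qed.

Lemma tile_rows eps : tile eps = \bigcup_(j in digit_range m) (place eps j @` tile (eps / P)).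
Proof.
have P0 := base_neq0 R hm hp.
have shift j v h : `|X (unplace eps j v) - eps / P * X h| = `|X v - eps * ((X h + beta j) / P)|.
  by rewrite /unplace coordE; congr `| _ |; field.
apply/seteqP; split=> [v [g Gg [Yg Xv]]|v [j hj /mem_place [h Gh [Yh Xh]]]].
  have [j hj [h Gh [eX eY]]] := digit_graph_step hm hp Gg.
  exists j => //; apply/mem_place; exists h => //; split.
    by rewrite /unplace coordE -Yg eY addrK.
  by rewrite shift -eX (mulrC P) mulfK.
exists (branch p j h); first exact: digit_graph_branch.
move: Yh; rewrite /unplace coordE /branch !coordE => ->; split; last by rewrite -shift.
by field.
Qed.

Lemma interior_tile_strip eps v : (tile eps)° v -> `|Y v| < 1 / 2.
Proof.
move=> iv; have := @tile_strip R p m eps v (interior_subset iv).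
move=> /andP[h1 h2]; rewrite ltr_norml !lt_neqAle h1 h2 !andbT.
have cw (a : R) : continuous (fun t : R => vec2 (X v) (Y v + a * t)).
  apply: continuous_vec2; first exact: continuous_const.
  apply: continuous_add; first exact: continuous_const.
  by apply: continuous_mul; [exact: continuous_const|move=> ?; exact: cvg_id].
have out (a : R) : exists2 t, 0 < t & - (1 / 2) <= Y v + a * t <= 1 / 2.
  have : nbhs (0 : R) [set t | tile eps (vec2 (X v) (Y v + a * t))].
    by apply: (cw a 0); rewrite mulr0 addr0 vec2_surj.
  move=> /nbhs_ballP[e /= e0 he]; exists (e / 2); first by rewrite divr_gt0.
  have : ball (0 : R) e (e / 2) by rewrite /ball /= sub0r normrN gtr0_norm; lra.
  by move=> /he /tile_strip; rewrite /strip /= coordE.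
apply/andP; split; apply/eqP => e.
- by have [t t0] := out (-1); rewrite -e; lra.
- by have [t t0] := out 1; rewrite e; lra.
Qed.

(** Within the open row [k] the slices are intervals of length 1 whose centres
    tend to [eps * (zc + beta k) / P] at the ends of the row, by graph_corner. *)
Lemma tile_below_boundary eps v k : tile eps v ->
  k%:~R - 1 / 2 < P * Y v < k%:~R + 1 / 2 ->
  digit_range m k /\ `|X v - eps * (zc + beta k) / P| <=
    1 / 2 + `|eps / P| * (4 * `|P| * (1 / 2 - `|P * Y v - k%:~R|)).
Proof.
have P0 := base_neq0 R hm hp.
rewrite tile_rows => -[j hj /mem_place [h Gh [Yh Xh]]] hk.
have [_ ] := digit_graph_box Gh; rewrite Yh /unplace coordE => Yj.
have jk : j = k.
  apply/eqP/negP => /negP /(int_dist_ge1 R); rewrite intrD intrN leNgt => /negP; apply.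
  by move: Yj; rewrite ler_norml ltr_norml => ?; lra.
rewrite -jk; split=> //.
have corner := graph_corner hm hp Gh; rewrite Yh /unplace coordE in corner.
move: Xh; rewrite /unplace coordE => Xh.
rewrite (_ : X v - _ = (X v - eps * beta j / P - eps / P * X h) + eps / P * (X h - zc)); last first.
  by field.
apply: le_trans (ler_normD _ _) _; rewrite lerD // normrM; exact: ler_wpM2l.
Qed.

Lemma le_small_error (a b K e : R) : 0 < e ->
  (forall d, 0 < d < e -> a <= b + K * d) -> a <= b.
Proof.
move=> e0 h; apply/ler_addgt0Pr => g g0.
have K1 : 0 < `|K| + 1 by rewrite ltr_wpDl.
pose d := Num.min (e / 2) (g / (`|K| + 1)).
have d0 : 0 < d by rewrite lt_min !divr_gt0.
have de : d < e.
  by have : d <= e / 2 by [rewrite ge_min lexx]; lra.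
have dg : d * (`|K| + 1) <= g by rewrite -ler_pdivlMr // ge_min lexx orbT.
have := h d; rewrite d0 de => /(_ isT); move=> /le_trans; apply; rewrite lerD2l.
apply: le_trans dg; rewrite mulrC ler_wpM2l ?ltW //.
by have := ler_norm K; lra.
Qed.

(** Here [v] is an interior point of the tile on an edge of the row [k], which is
    the upper or the lower edge according to the signs of [s] and [P].  Slices of
    that row near the edge contain a fixed interval around [X v], and so does
    their limit. *)
Lemma boundary_slice_limit eps v k (s : R) : (tile eps)° v -> `|s| = 1 / 2 ->
  P * Y v = k%:~R + s ->
  exists2 e, 0 < e & forall x, `|x - X v| < e ->
    `|x - eps * (zc + beta k) / P| <= 1 / 2.
Proof.
move=> /nbhs_ballP[e /= e0 he] hs Yv.
have P0 := base_neq0 R hm hp; have P3 := base_ge3 R hm hp.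
have Pgt0 : 0 < `|P| by lra.
exists e => // x xe; pose e1 := Num.min e (1 / 2).
have e10 : 0 < e1 by rewrite lt_min e0 divr_gt0.
apply: (@le_small_error _ _ (`|eps / P| * (4 * `|P|)) e1) => // d /andP[d0 de1].
have [de d1] : d < e /\ d < 1 / 2.
  by split; apply: lt_le_trans de1 _; rewrite ge_min lexx ?orbT.
(* The height at relative distance [d] from the edge, on the side of the row [k]. *)
pose y := (k%:~R + s * (1 - 2 * d)) / P.
have Py : P * y - k%:~R = s * (1 - 2 * d) by rewrite /y; field.
have nPy : `|P * y - k%:~R| = 1 / 2 - d.
  by rewrite Py normrM hs ger0_norm; lra.
have T : tile eps (vec2 x y).
  apply: he; rewrite -ball_normE /ball_ /= sup_norm_plane abscissaB ordinateB !coordE.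
  rewrite gt_max distrC xe /=.
  rewrite -(ltr_pM2l Pgt0) -normrM mulrBr Yv.
  rewrite (_ : _ + s - P * y = s * (2 * d)); last by rewrite /y; field.
  rewrite normrM hs ger0_norm; last by lra.
  have := ler_wpM2r (ltW e0) P3; lra.
have [|_] := @tile_below_boundary _ _ k T.
  rewrite coordE; move: nPy => /eqP; rewrite eq_le => /andP[+ _].
  by rewrite ler_norml => ?; lra.
rewrite !coordE nPy; move/le_trans; apply; rewrite lerD2l.
by rewrite (_ : 1 / 2 - (1 / 2 - d) = d) ?mulrA //; ring.
Qed.

Lemma place_interior_ordinate eps eps' j v : (place eps j @` (tile eps')°) v ->
  `|P * Y v - j%:~R| < 1 / 2.
Proof. by move=> /mem_place /interior_tile_strip; rewrite /unplace coordE. Qed.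

Lemma place_of_ordinate (eps eps' : R) i j v : (place eps i @` tile eps') v ->
  `|P * Y v - j%:~R| < 1 / 2 -> i = j.
Proof.
move=> /mem_place /tile_strip; rewrite /strip /= /unplace coordE => h1 h2.
apply/eqP/negP => /negP /(int_dist_ge1 R); rewrite intrD intrN leNgt => /negP; apply.
by move: h2; rewrite !ltr_norml => ?; lra.
Qed.

(** An interior point on an edge of a row lies on the edges of two consecutive
    rows, and the two limit slices would have an interval in common, although
    their centres are at distance [|eps / P| >= 1]. *)
Lemma interior_tile_rows eps : `|P| <= `|eps| ->
  (tile eps)° = \bigcup_(j in digit_range m) (place eps j @` (tile (eps / P))°).
Proof.
move=> heps; have P0 := base_neq0 R hm hp; have P3 := base_ge3 R hm hp.
have rowI j (A : set V) : (place eps j @` A)° = place eps j @` A°.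
  exact: (interior_homeo (@continuous_place eps j) (@continuous_unplace eps j)
    (placeK eps j) (unplaceK eps j)).
apply/seteqP; split; last first.
  move=> v [j hj]; rewrite -rowI; apply: interiorS.
  by rewrite [X in _ `<=` X]tile_rows => w hw; exists j.
move=> v iv; have := interior_subset iv; rewrite tile_rows => -[j hj rv].
have /mem_place/tile_strip := rv; rewrite /strip /= /unplace coordE => hY.
have Yle : `|P * Y v - j%:~R| <= 1 / 2 by rewrite ler_norml.
exists j => //; rewrite -rowI.
have [near|edge] := ltP `|P * Y v - j%:~R| (1 / 2).
  have cY := @continuous_ordinate R.
  have cd : continuous (fun w : V => `|P * Y w - j%:~R|).
    apply: (@continuous_after _ _ _ (fun w : V => P * Y w - j%:~R) (fun x : R => `|x|)).
      apply: continuous_sub; last exact: continuous_const.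
      by apply: continuous_mul => //; exact: continuous_const.
    exact: norm_continuous.
  apply: filterS2 iv (continuous_near_lt (cd v) near) => w.
  rewrite tile_rows => -[i hi ri] hw.
  by rewrite -(place_of_ordinate ri hw).
exfalso.
have hs : `|P * Y v - j%:~R| = 1 / 2 by apply: le_anti; rewrite Yle edge.
pose s := P * Y v - j%:~R.
(* The other row that has the point [v] on its edge. *)
have [k [bk hk]] : exists k, `|beta j - beta k| = 1 /\ P * Y v = k%:~R + - s.
  have [s0|s0] : s = 1 / 2 \/ s = - (1 / 2).
    by move: hs; rewrite -/s; case: (ger0P s) => _ ?; [left|right]; lra.
    exists (j + 1); split; first by rewrite distrC odd_part_succ.
    by rewrite intrD -[1%:~R]/1; move: s0; rewrite /s; lra.
  exists (j - 1); split; first by rewrite -{1}(subrK 1 j) odd_part_succ.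
  by rewrite intrB -[1%:~R]/1; move: s0; rewrite /s; lra.
have hj' : P * Y v = j%:~R + s by rewrite /s; ring.
have [e1 e10 h1] := boundary_slice_limit iv hs hj'.
have [|e2 e20 h2] := @boundary_slice_limit eps v k (- s) iv _ hk; first by rewrite normrN.
pose e := Num.min e1 e2.
have e0 : 0 < e by rewrite lt_min e10.
have [ee1 ee2] : e <= e1 /\ e <= e2 by rewrite !ge_min !lexx orbT.
have [half1 half2] : e / 2 < e1 /\ e / 2 < e2 by clear -e0 ee1 ee2; lra.
have e20' : 0 < e / 2 by rewrite divr_gt0.
have dp : `|X v + e / 2 - X v| = e / 2 by rewrite addrC addKr gtr0_norm.
have dm : `|X v - e / 2 - X v| = e / 2 by rewrite addrC addKr normrN gtr0_norm.
have := h1 (X v + e / 2); have := h1 (X v - e / 2).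
have := h2 (X v + e / 2); have := h2 (X v - e / 2).
rewrite dp dm; set c := eps * (zc + beta j) / P; set c' := eps * (zc + beta k) / P.
have cc : 1 <= `|c - c'|.
  rewrite (_ : c - c' = eps / P * (beta j - beta k)); last by rewrite /c /c'; field.
  rewrite normrM bk mulr1 normrM normfV ler_pdivlMr ?mul1r //; lra.
move=> /(_ half2) + /(_ half2) + /(_ half1) + /(_ half1).
rewrite !ler_distl => ? ? ? ?.
suff : `|c - c'| < 1 by rewrite ltNge cc.
by rewrite ltr_distl; lra.
Qed.

End TileDecomposition.

(** * Counting the components *)

(** The bijection is the numbering of pairs in base [b]. *)
Lemma card_setX_II (T U : Type) (A : set T) (B : set U) (a b : nat) :
  (A #= `I_a)%card -> (B #= `I_b)%card -> (A `*` B #= `I_(a * b))%card.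
Proof.
move=> /card_set_bijP[f [f1 f2 f3]] /card_set_bijP[g [g1 g2 g3]].
apply/card_set_bijP; exists (fun q => f q.1 * b + g q.2)%N; split.
- move=> [x y] [/= /f1 fx /g1 gy] /=.
  by apply: (@leq_trans (f x * b + b)%N); [rewrite ltn_add2l|rewrite -mulSnr leq_mul2r fx orbT].
- move=> [x y] [x' y'] /set_mem[/= Ax By] /set_mem[/= Ax' By'] e.
  have gy : (g y < b)%N := g1 _ By; have gy' : (g y' < b)%N := g1 _ By'.
  have b0 : (0 < b)%N by exact: leq_ltn_trans gy.
  have ef : f x = f x'.
    by move/(congr1 (divn^~ b)): e; rewrite !divnMDl // !divn_small // !addn0.
  have eg : g y = g y' by move: e; rewrite ef => /addnI.
  have -> : x = x' by apply: f2 => //; exact: mem_set.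
  by have -> : y = y' by apply: g2 => //; exact: mem_set.
- move=> k /= kab; have b0 : (0 < b)%N by case: b kab {g1 g3} => //; rewrite muln0.
  have [|x Ax fx] := f3 (k %/ b)%N; first by rewrite /= ltn_divLR.
  have [|y By gy] := g3 (k %% b)%N; first by rewrite /= ltn_mod.
  by exists (x, y) => //=; rewrite fx gy -divn_eq.
Qed.

Lemma card_pairs (T U W : Type) (A : set T) (B : set U) (a b : nat) (F : T -> U -> W) :
  (A #= `I_a)%card -> (B #= `I_b)%card ->
  (forall x y x' y', A x -> B y -> A x' -> B y' -> F x y = F x' y' -> x = x' /\ y = y') ->
  ([set F x y | x in A & y in B] #= `I_(a * b))%card.
Proof.
move=> Aa Bb injF; rewrite image2E.
apply: card_eq_trans (card_setX_II Aa Bb).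
apply: inj_card_eq => -[x y] [x' y'] /set_mem[/= Ax By] /set_mem[/= Ax' By'] e.
by have [-> ->] := injF _ _ _ _ Ax By Ax' By' e.
Qed.

Section TileComponents.
Variables (R : realType) (p : int) (m : nat).
Hypotheses (hm : (1 <= m)%N) (hp : `|p| = (2 * m + 1)%N%:Z).
Local Notation V := 'cV[R]_2.
Local Notation X := (@abscissa R).
Local Notation Y := (@ordinate R).
Local Notation P := (p%:~R : R).
Local Notation beta := (@odd_part R).
Local Notation tile := (@tile R p m).
Local Notation place := (@place R p).

Lemma place_component_ordinate eps j C v :
  (exists2 x, (tile (eps / P))° x & C = connected_component (tile (eps / P))° x) ->
  (place eps j @` C) v -> `|P * Y v - j%:~R| < 1 / 2.
Proof.
move=> [x _ ->] [w /connected_component_sub iw <-].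
apply: (@place_interior_ordinate R p m hm hp eps (eps / P)).
by exists w.
Qed.

Lemma rows_same_ordinate (v : V) i j :
  `|P * Y v - i%:~R| < 1 / 2 -> `|P * Y v - j%:~R| < 1 / 2 -> i = j.
Proof.
move=> h1 h2; apply/eqP/negP => /negP /(int_dist_ge1 R).
rewrite intrD intrN leNgt => /negP; apply.
by move: h1 h2; rewrite !ltr_norml => ? ?; lra.
Qed.

Lemma components_tile_rows eps : `|P| <= `|eps| ->
  components (tile eps)° =
  [set place eps j @` C | j in digit_range m & C in components (tile (eps / P))°].
Proof.
move=> heps; rewrite (interior_tile_rows hm hp heps).
have cr := @continuous_place R p eps; have cu := @continuous_unplace R p eps.
have rK := @placeK R p m hm hp eps; have uK := @unplaceK R p m hm hp eps.
set F := fun j => place eps j @` (tile (eps / P))°.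
have oF i : digit_range m i -> open (F i).
  by move=> _; rewrite /F -(interior_homeo (@cr i) (@cu i) (rK i) (uK i)); exact: open_interior.
have dF i k y : digit_range m i -> digit_range m k -> F i y -> F k y -> i = k.
  by move=> _ _ /(place_interior_ordinate hm hp) h1 /(place_interior_ordinate hm hp); exact: rows_same_ordinate.
apply/seteqP; split.
  move=> _ [v [j hj Fv] <-]; rewrite (component_of_piece hj oF dF Fv).
  exists j => //; exists (connected_component (tile (eps / P))° (unplace p eps j v)).
    by exists (unplace p eps j v) => //; apply/(mem_place hm hp).
  rewrite -(connected_component_homeo (@cr j) (@cu j) (rK j) (uK j)); first by rewrite uK.
  exact/(mem_place hm hp).
move=> _ [j hj [_ [w Tw <-] <-]].
have Fw : F j (place eps j w) by exists w.
exists (place eps j w); first by exists j.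
rewrite (component_of_piece hj oF dF Fw).
by rewrite (connected_component_homeo (@cr j) (@cu j) (rK j) (uK j)).
Qed.

(** Induction on [n]: division of [eps] by the base lowers the exponent by one,
    and the components for [eps] are the placed components for [eps / P]. *)
Lemma tile_components n eps : `|eps| < `|P| ^+ n.+1 -> (n = 0%N \/ `|P| ^+ n <= `|eps|) ->
  (components (tile eps)° #= `I_(`|p|%N ^ n))%card /\
  (forall C, components (tile eps)° C -> disk_like (closure C)).
Proof.
have P3 := base_ge3 R hm hp; have Pgt0 : 0 < `|P| by lra.
elim: n eps => [|n IH] eps lt ge.
  rewrite expr1 in lt.
  have [cT T0 clT] := tile_interior_small hm hp lt.
  rewrite (components_connected T0 cT) expn0; split; first exact: card_set1.
  by move=> _ ->; rewrite clT; case: (tile_region hm hp lt).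
have {}ge : `|P| ^+ n.+1 <= `|eps| by case: ge.
have heps : `|P| <= `|eps|.
  apply: le_trans ge; rewrite exprS ler_peMr ?(ltW Pgt0) //.
  by apply: exprn_ege1; lra.
have [||cardC diskC] := IH (eps / P).
- by rewrite normrM normfV ltr_pdivrMr // -exprSr.
- by right; rewrite normrM normfV ler_pdivlMr // -exprSr.
have P0 := base_neq0 R hm hp.
have rK := @placeK R p m hm hp eps; have uK := @unplaceK R p m hm hp eps.
rewrite (components_tile_rows heps); split.
  rewrite expnS; apply: card_pairs => //.
    have -> : `|p|%N = (2 * m + 1)%N by move: hp; lia.
    exact: card_digit_range.
  move=> i _ j _ hi [x Tx <-] hj [y Ty <-] e.
  have rv : (place eps i @` connected_component (tile (eps / P))° x) (place eps i x).
    by exists x => //; exact: connected_component_refl.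
  have ij : i = j.
    apply: (@rows_same_ordinate (place eps i x)).
      by apply: place_component_ordinate rv; exists x.
    by rewrite e in rv; apply: place_component_ordinate rv; exists y.
  have pre (D : set V) : place eps j @^-1` (place eps j @` D) = D.
    apply/seteqP; split=> [w [w' Dw' /(can_inj (rK j)) <-] //|w Dw].
    by exists w.
  by split=> //; move: e; rewrite ij => /(congr1 (fun A => place eps j @^-1` A)); rewrite !pre.
move=> _ [j hj [C hC <-]].
rewrite (closure_homeo (@continuous_place R p eps j) (@continuous_unplace R p eps j) (rK j) (uK j)).
have image := disk_like_image (@continuous_place R p eps j) (@continuous_unplace R p eps j)
  (rK j) (uK j).
exact: image (diskC C hC).
Qed.

Lemma tile_interior_nonempty eps : (tile eps)° !=set0.
Proof.
have P3 := base_ge3 R hm hp; have Pgt0 : 0 < `|P| by lra.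
have [n hn] := geometric_small hm hp `|eps| (e := `|P|) Pgt0.
rewrite ltr_pdivrMr ?exprn_gt0 // -exprS in hn.
elim: n eps hn => [|n IH] eps hn; first by case: (tile_interior_small hm hp hn).
have [|v iv] := IH (eps / P).
  by rewrite normrM normfV ltr_pdivrMr // -exprSr.
have rK := @placeK R p m hm hp eps; have uK := @unplaceK R p m hm hp eps.
exists (place eps 0 v); suff : place eps 0 @` tile (eps / P) `<=` tile eps.
  move/interiorS; apply.
  rewrite (interior_homeo (@continuous_place R p eps 0) (@continuous_unplace R p eps 0) (rK 0) (uK 0)).
  by exists v.
rewrite [X in _ `<=` X](tile_rows hm hp) => w hw; exists 0 => //.
Qed.

End TileComponents.

(** * The tile as a self-affine set *)

Section Generation.
Variables (R : realType) (p : int) (m : nat).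
Hypotheses (hm : (1 <= m)%N) (hp : `|p| = (2 * m + 1)%N%:Z).
Local Notation V := 'cV[R]_2.
Local Notation X := (@abscissa R).
Local Notation Y := (@ordinate R).
Local Notation P := (p%:~R : R).
Local Notation beta := (@odd_part R).
Local Notation tile := (@tile R p m).
Local Notation A := (P%:M : 'M[R]_2).

Lemma invmx_base (v : V) : invmx A *m v = P^-1 *: v.
Proof. by rewrite invmx_scalar mul_scalar_mx. Qed.

(** Any two sets generated by the same data are at finite distance, and one
    application of the generating maps contracts this distance by [1/|p|]. *)
Lemma generated_subset (D S T : set V) :
  generated_by A D S -> generated_by A D T -> S `<=` T.
Proof.
move=> [cS _ eS] [cT [t0 Tt0] eT] s Ss.
have P3 := base_ge3 R hm hp; have Pgt0 : 0 < `|P| by lra.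
have bounded (U : set V) : compact U -> exists B : R, forall u, U u -> `|u| <= B.
  by move=> /compact_bounded[M [_ hM]]; exists (M + 1) => u Uu; apply: hM => //; rewrite ltrDl.
have [B1 hB1] := bounded S cS; have [B2 hB2] := bounded T cT.
have approx n x : S x -> exists2 y, T y & `|x - y| <= (B1 + B2) / `|P| ^+ n.
  elim: n x => [|n IH] x Sx.
    exists t0 => //; rewrite expr0 divr1; apply: le_trans (ler_normB _ _) _.
    by apply: lerD; [exact: hB1|exact: hB2].
  move: Sx; rewrite eS => -[x' Sx' [e De <-]]; have [y' Ty' hy'] := IH x' Sx'.
  exists (invmx A *m (y' + e)); first by rewrite eT; exists y' => //; exists e.
  rewrite !invmx_base -scalerBr normrZ normfV opprD addrACA subrr addr0.
  by rewrite exprSr invfM mulrA [leRHS]mulrC ler_wpM2l ?invr_ge0.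
have clT : closed T by apply: compact_closed cT; exact: plane_hausdorff.
rewrite (iffLR (closure_id T) clT) => U /nbhs_ballP[e /= e0 hU].
have [n hn] := geometric_small hm hp (B1 + B2) e0.
have [y Ty hy] := approx n s Ss.
exists y; split=> //; apply: hU; rewrite -ball_normE /ball_ /=.
exact: le_lt_trans hn.
Qed.

(** Over a given point of the graph, the horizontal digits [i] translate an
    interval of length 1 so as to tile an interval of length [|p|]. *)
Lemma tile_generated eps : generated_by A (digits m eps) (tile eps).
Proof.
have P3 := base_ge3 R hm hp; have Pgt0 : 0 < `|P| by lra.
have P0 := base_neq0 R hm hp; have Pn := base_norm R hp.
have shiftE j : digit_shift eps j = beta j * eps by [].
split; first exact: compact_tile.
  by have [v /interior_subset] := tile_interior_nonempty hm hp eps; exists v.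
apply/seteqP; split=> [v [g Gg [Yg Xv]]|_ [t [h Gh [Yh Xh]] [_ [i hi [j hj <-]] <-]]].
  have [j hj [h Gh [eX eY]]] := digit_graph_step hm hp Gg.
  have [|i hi hi'] := @digit_near R m (P * (X v - eps * X g)).
    rewrite normrM; apply: le_trans (ler_wpM2l _ Xv) _ => //; rewrite Pn; lra.
  exists (vec2 (P * X v - i%:~R - beta j * eps) (Y h)).
    exists h => //; rewrite !coordE; split=> //.
    rewrite (_ : _ - eps * X h = P * (X v - eps * X g) - i%:~R) //.
    by rewrite mulrBr mulrCA eX; ring.
  exists (vec2 (i%:~R + digit_shift eps j) j%:~R); first by exists i => //; exists j.
  rewrite invmx_base shiftE; apply: vec2_eq.
    by rewrite abscissaZ abscissaD !coordE; field.
  rewrite ordinateZ ordinateD !coordE -eY Yg; field.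
  exact: P0.
exists (branch p j h); first exact: digit_graph_branch.
rewrite invmx_base shiftE ordinateZ ordinateD abscissaZ abscissaD /branch !coordE Yh; split.
  by rewrite mulrC.
rewrite (_ : _ - _ = P^-1 * ((X t - eps * X h) + i%:~R)); last by field.
rewrite normrM normfV ler_pdivrMl //; apply: le_trans (ler_normD _ _) _.
by have := digit_le R hi; rewrite Pn; lra.
Qed.

Lemma self_affine_set_tile eps : self_affine_set A (digits m eps) = tile eps.
Proof.
have gT := tile_generated eps.
apply: xget_unique; first split=> //.
  by move=> T' gT'; apply/seteqP; split; [exact: generated_subset gT' gT|exact: generated_subset gT gT'].
by move=> T' [gT' _]; apply/seteqP; split; [exact: generated_subset gT' gT|exact: generated_subset gT gT'].
Qed.

Lemma base_integer : integer_mx A.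
Proof. by move=> i j; rewrite mxE; apply: rpredMn; exact: intr_int. Qed.

Lemma base_expanding : expanding A.
Proof.
move=> z; rewrite map_scalar_mx => /eigenvalueP[v].
rewrite mul_mx_scalar => e v0.
have -> : z = p%:~R.
  apply/eqP; rewrite eq_sym -subr_eq0; move/eqP: e.
  by rewrite -subr_eq0 -scalerBl scaler_eq0 (negPf v0) orbF rmorph_int.
by rewrite -intr_norm hp -pmulrn ltr1n; lia.
Qed.

Lemma base_similarity : similarity_mx A.
Proof.
have P3 := base_ge3 R hm hp.
exists `|P|; first by lra.
by move=> x y; rewrite !mul_scalar_mx -scalerBr enormZ.
Qed.

Lemma card_digits_det (eps : R) :
  exists2 n : nat, (digits m eps #= `I_n)%card & n%:R = `|\det A|.
Proof.
exists ((2 * m + 1) * (2 * m + 1))%N; last first.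
  by rewrite det_scalar expr2 normrM (base_norm R hp) natrM natrD natrM.
apply: card_pairs; try exact: card_digit_range.
move=> i j i' j' _ _ _ _ e.
have := congr1 Y e; rewrite !coordE => /intr_inj ej.
have := congr1 X e; rewrite !coordE ej => /addIr /intr_inj -> //.
Qed.

End Generation.

Theorem theorem1p1 (R : realType) (p : int) (m : nat) (eps : R)
    (hm : (1 <= m)%N) (hp : `|p| = (2 * m + 1)%N%:Z) :
  let A : 'M[R]_2 := (p%:~R)%:M in
  let D : set 'cV[R]_2 := digits m eps in
  let T : set 'cV[R]_2 := self_affine_set A D in
  [/\ self_similar_tile A D T,
      `|eps| < `|p%:~R| -> disk_like T &
      forall n : nat, (1 <= n)%N ->
        `|p%:~R| ^+ n <= `|eps| < `|p%:~R| ^+ n.+1 ->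
        (components (T°) #= `I_(`|p|%N ^ n))%card /\
        (forall C, components (T°) C -> disk_like (closure C))].
Proof.
move=> A D T; rewrite /T /D /A (self_affine_set_tile hm hp); split.
- split; last exact: (base_similarity R hm hp).
  split; [split|exact: (card_digits_det hp)|by rewrite (self_affine_set_tile hm hp)|].
  + exact: (base_integer R p).
  + exact: (@base_expanding R p m hm hp).
  + exact: (tile_interior_nonempty hm hp).
- by move=> heps; case: (tile_region hm hp heps).
- move=> n _ /andP[ge lt]; by apply: (tile_components hm hp lt); right.
Qed.
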